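(* Let $B$ be a finite Blaschke product whose order (degree) $n$ is a prime number, and let $g$ be a bounded analytic function on the unit disk $\mathbb{D}$. If $g$ is not in $H^\infty[B]$, then $\Gamma(g)$ does not vanish identically.
   Context: $\mathbb{D}$ is the open unit disk, and $H^\infty[B]=\{h\circ B: h\in H^\infty(\mathbb{D})\}$. The Blaschke product is $B(z)=\prod_{j=1}^n\frac{a_j-z}{1-\bar a_j z}$ with $a_1,\dots,a_n\in\mathbb{D}$. For $z\in\mathbb{D}$ there are exactly $n$ points of $\mathbb{D}$, counted with multiplicity, at which $B$ takes the value $B(z)$; they are denoted $z=\varphi_0(z),\varphi_1(z),\dots,\varphi_{n-1}(z)$. For $f$ holomorphic in $\mathbb{D}$, $\Gamma(f)$ is the holomorphic function on $\mathbb{D}$ given at points with $B'(z)\ne0$ by $\Gamma(f)(z)=\prod_{j=1}^{n-1}\frac{f(z)-f(\varphi_j(z))}{z-\varphi_j(z)}$ (the remaining singularities are removable). *)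

(* Defs.v *)
From HB Require Import structures.
From mathcomp Require Import all_boot all_order all_algebra.
From mathcomp Require Import all_classical all_reals all_analysis.
From mathcomp Require Export complex.

Set Implicit Arguments.
Unset Strict Implicit.
Unset Printing Implicit Defensive.

Import Order.TTheory GRing.Theory Num.Theory.
Import numFieldNormedType.Exports.

Local Open Scope classical_set_scope.
Local Open Scope ring_scope.

(* R[i] packed as a numFieldType, so that the normed module structure of a
   numFieldType over itself, here over the complex scalars, is inferred. *)
Definition cplx (R : realType) : numFieldType := R[i].

Definition unit_disk (R : realType) : set (cplx R) := [set z | `|z| < 1].

(* The scalars being cplx R, derivability in the direction 1 is complex
   differentiability. Functions are total; only their values on the disk matter. *)
Definition holomorphic (R : realType) (f : cplx R -> cplx R) : Prop :=
  forall z, unit_disk z -> derivable f z 1.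

Definition Hinfty (R : realType) (f : cplx R -> cplx R) : Prop :=
  holomorphic f /\ [bounded f z | z in @unit_disk R].

Definition blaschke (R : realType) (n : nat) (a : 'I_n -> cplx R)
    (z : cplx R) : cplx R :=
  \prod_(j < n) ((a j - z) / (1 - (a j)^*%C * z)).

Definition Hinfty_comp (R : realType) (B f : cplx R -> cplx R) : Prop :=
  exists h, Hinfty h /\ forall z, unit_disk z -> f z = h (B z).

(* For m = 0 this says that F w != 0. *)
Definition zero_of_order (R : realType) (F : cplx R -> cplx R) (w : cplx R)
    (m : nat) : Prop :=
  exists h, [/\ holomorphic h, h w != 0 &
    forall u, unit_disk u -> F u = (u - w) ^+ m * h u].

(* s lists the points of the disk at which B takes the value B z, each one
   repeated according to its multiplicity. *)
Definition is_fiber (R : realType) (B : cplx R -> cplx R) (z : cplx R)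
    (s : seq (cplx R)) : Prop :=
  (forall w, w \in s -> unit_disk w) /\
  (forall w, unit_disk w ->
     zero_of_order (fun u => B u - B z) w (count_mem w s)).

(* [:: phi_0 z; ...; phi_(n-1) z] in some order; it is determined by is_fiber up
   to permutation, and the default [::] is never used for a finite Blaschke
   product B and z in the disk. *)
Definition fiber (R : realType) (B : cplx R -> cplx R) (z : cplx R) :
    seq (cplx R) :=
  xget [::] [set s | is_fiber B z s].

(* rem z removes one occurrence of z, namely phi_0 z. *)
Definition Gamma_prod (R : realType) (B f : cplx R -> cplx R) (z : cplx R) :
    cplx R :=
  \prod_(w <- rem z (fiber B z)) ((f z - f w) / (z - w)).

(* The zeros of B' in the disk are isolated, and the holomorphic extension takes
   there the value of the limit. *)
Definition Gamma (R : realType) (B f : cplx R -> cplx R) (z : cplx R) : cplx R :=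
  if derive1 B z != 0 then Gamma_prod B f z
  else lim (Gamma_prod B f w @[w --> z^']).

(* Main.v *)
From HB Require Import structures.
Require Import Defs.
From mathcomp Require Import all_boot all_order all_algebra.
From mathcomp Require Import all_classical all_reals all_analysis.
From mathcomp Require Import ring lra.
Set Implicit Arguments.
Unset Strict Implicit.
Unset Printing Implicit Defensive.
Import Order.TTheory GRing.Theory Num.Theory.
Import numFieldNormedType.Exports.
Local Open Scope classical_set_scope.
Local Open Scope ring_scope.

(** Write B = P / Q, where P and Q are the products over j of a_j - z and of
    1 - conj(a_j) z.  For w in the disk, the polynomial P - w Q has degree n and
    its roots all lie in the disk, so they are the fibre of B over w, listed
    with multiplicity ([fiber_sols]); they are distinct unless w belongs to a
    finite set of critical values ([critical_values]).

    The theorem expresses that an extension of prime degree n has no proper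
    intermediate field: g has degree 1 or n over the functions of B.  In place
    of fields the proof counts coincidences.  For z in the disk put
      gap z = prod_(x in the fibre through z) (X + g z - g x).
    The first nonzero coefficient of gap z has as index the number of x in the
    fibre through z with g x = g z ([gap_order]).  Each coefficient is symmetric
    in the fibre, hence bounded and, as a function of z, holomorphic off the
    critical fibres, where the points of the fibre can be followed
    differentiably ([branches]).  Let k be the least index of a coefficient that
    does not vanish identically.  As its zeros are isolated, some regular fibre
    avoids them all ([generic_fibre]); on that fibre g takes each of its values
    exactly k times, so k divides n.  If Gamma g vanishes identically, every
    point of a regular fibre shares its value under g with another point of the
    fibre, so k > 1, and k = n because n is prime.  Thus g is constant on
    regular fibres, that is g = h o B there; h is bounded, and extends
    holomorphically over the finitely many critical values.

    Two facts of complex analysis are used for functions that are only assumed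
    to be differentiable: isolated zeros ([isolated_zeros]) and removable
    singularities ([removable]).  Both follow from the estimate [md_center_le]:
    |f c| <= 2 sup |f|, the supremum being taken over the border of a square
    with centre c, and finitely many points being allowed near which f is merely
    bounded.  It is obtained without integrals.  The midpoint sums of a function
    along the dyadic subdivisions of the border of a square are exact for affine
    functions and additive when the square is cut into four, so the bisection
    argument of Goursat shows that they tend to 0; for (f z - f c) / (z - c)
    this compares f c with the values of f on the border. *)

(** * The modulus, continuity and complex differentiability *)

Section Complex.
Variable R : realType.
Implicit Types (z w u : cplx R) (f g phi : cplx R -> cplx R).

(** The norm of cplx R takes values in cplx R, where the order is only partial;
    estimates are carried out in R with this modulus. *)
Definition md z : R := ComplexField.Normc.normc z.

Lemma mdE z : `|z| = ((md z)%:C)%C :> cplx R.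
Proof. by []. Qed.

Lemma mdM z w : md (z * w) = md z * md w.
Proof. exact: ComplexField.Normc.normcM. Qed.

Lemma mdD z w : md (z + w) <= md z + md w.
Proof. exact: complex.le_normcD. Qed.

Lemma mdN z : md (- z) = md z.
Proof. exact: complex.normcN. Qed.

Lemma md_ge0 z : 0 <= md z.
Proof. by case: z => a b; apply: sqrtr_ge0. Qed.

Lemma md0 : md 0 = 0.
Proof. exact: ComplexField.Normc.normc0. Qed.

Lemma md1 : md 1 = 1.
Proof. exact: ComplexField.Normc.normc1. Qed.

Lemma md_eq0 z : (md z == 0) = (z == 0).
Proof.
by apply/eqP/eqP => [|->]; [exact: ComplexField.Normc.eq0_normc | exact: md0].
Qed.

Lemma md_gt0 z : (0 < md z) = (z != 0).
Proof. by rewrite lt_def md_ge0 andbT md_eq0. Qed.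

Lemma mdV z : md (z^-1) = (md z)^-1.
Proof. exact: ComplexField.Normc.normcV. Qed.

Lemma mdX z n : md (z ^+ n) = md z ^+ n.
Proof. by elim: n => [|n IH]; rewrite ?expr0 ?md1 // !exprS mdM IH. Qed.

Lemma mdBC z w : md (z - w) = md (w - z).
Proof. by rewrite -mdN opprB. Qed.

Lemma mdB_ge z w : md z - md w <= md (z - w).
Proof. by rewrite lerBlDr; have := mdD (z - w) w; rewrite subrK. Qed.

Lemma md_real (x : R) : md (x%:C)%C = `|x|.
Proof. by rewrite /md /= expr0n /= addr0 sqrtr_sqr. Qed.

Lemma md_conj z : md (z^*)%C = md z.
Proof. by case: z => a b; rewrite /md /= sqrrN. Qed.

Lemma Re_le_md z : `|complex.Re z| <= md z.
Proof.
case: z => a b /=; rewrite /md /= -sqrtr_sqr; apply: ler_wsqrtr.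
by rewrite lerDl sqr_ge0.
Qed.

Lemma Im_le_md z : `|complex.Im z| <= md z.
Proof.
case: z => a b /=; rewrite /md /= -sqrtr_sqr; apply: ler_wsqrtr.
by rewrite lerDr sqr_ge0.
Qed.

Lemma md_le_ReIm z : md z <= `|complex.Re z| + `|complex.Im z|.
Proof.
case: z => a b; rewrite /md /= -[leRHS]ger0_norm ?addr_ge0 // -sqrtr_sqr.
apply: ler_wsqrtr; rewrite sqrrD !real_normK ?num_real //.
by have := mulr_ge0 (normr_ge0 a) (normr_ge0 b); lra.
Qed.

Lemma unit_diskE z : unit_disk z <-> md z < 1.
Proof.
rewrite /unit_disk /= mdE.
by change ((((md z)%:C)%C < (1%:C)%C) <-> (md z < 1)); rewrite ltcR.
Qed.

Lemma near_md z (P : set (cplx R)) :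
  (\forall u \near z, P u) <->
  exists2 d : R, 0 < d & forall u, md (u - z) < d -> P u.
Proof.
rewrite nbhs_normP; split.
  case=> e /= e0 eP; exists (complex.Re e).
    by move: e0; rewrite ltcE /= => /andP[].
  move=> u ud; apply: eP; rewrite /ball_ /= distrC mdE.
  have -> : e = ((complex.Re e)%:C)%C by rewrite RRe_real // gtr0_real.
  by rewrite ltcR.
case=> d d0 dP; exists ((d%:C)%C); first by rewrite /= (ltcR 0).
by move=> u; rewrite /ball_ /= distrC mdE ltcR => /dP.
Qed.

Lemma near_dnbhs_md z (P : set (cplx R)) :
  (\forall u \near z^', P u) <->
  exists2 d : R, 0 < d & forall u, u != z -> md (u - z) < d -> P u.
Proof.
split.
  by move=> /near_md [d d0 dP]; exists d => // u uz ud; apply: dP.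
case=> d d0 dP; apply/near_md; exists d => // u ud uz.
exact: dP.
Qed.

Lemma cvg_md {F : set_system (cplx R)} {FF : Filter F} f (l : cplx R) :
  f x @[x --> F] --> l <->
  (forall e : R, 0 < e -> \forall x \near F, md (f x - l) < e).
Proof.
split.
  move=> /cvgrPdist_lt h e e0.
  have /h : 0 < (e%:C)%C :> cplx R by rewrite (ltcR 0).
  by apply: filterS => x; rewrite distrC mdE ltcR.
move=> h; apply/cvgrPdist_lt => e e0.
have ee : e = ((complex.Re e)%:C)%C by rewrite RRe_real // gtr0_real.
have /h : 0 < complex.Re e by move: e0; rewrite ltcE /= => /andP[].
by apply: filterS => x; rewrite distrC mdE ee ltcR.
Qed.

Definition ccont f z : Prop := {for z, continuous f}.

(** Complex differentiability, sealed in an inductive predicate so that it is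
    treated as an atomic property of the function and not unfolded to a
    limit. *)
Variant cderivable f z : Prop := Cderivable of derivable f z 1.

Lemma cderivableP f z : cderivable f z <-> derivable f z 1.
Proof. by split=> [[]//|]; apply: Cderivable. Qed.

Lemma continuous_md f z :
  ccont f z <->
  forall e : R, 0 < e ->
    exists2 d : R, 0 < d & forall u, md (u - z) < d -> md (f u - f z) < e.
Proof.
split=> [fc e e0|h].
  by apply/near_md; apply: (cvg_md (F := nbhs z) f (f z)).1.
by apply/(cvg_md (F := nbhs z) f (f z)) => e e0; apply/near_md; apply: h.
Qed.

Lemma continuous_neq0 f z : ccont f z -> f z != 0 ->
  \forall u \near z, f u != 0.
Proof.
rewrite -md_gt0 => fc fz; have [d d0 dP] := (continuous_md f z).1 fc _ fz.
apply/near_md; exists d => // u /dP h; rewrite -md_gt0.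
by have := mdB_ge (f z) (f u); rewrite mdBC; lra.
Qed.

Lemma continuous_compose f g z : ccont f z ->
  ccont g (f z) -> ccont (fun u => g (f u)) z.
Proof. by move=> fc gc; exact: (@cvg_comp _ _ _ f g _ _ _ fc gc). Qed.

Lemma continuous_mul f g z : ccont f z ->
  ccont g z -> ccont (fun u => f u * g u) z.
Proof.
by move=> fc gc; exact: (@continuousM (cplx R) (cplx R) f g z fc gc).
Qed.

Lemma derivable_md f z :
  cderivable f z <->
  exists l, forall e : R, 0 < e -> exists2 d : R, 0 < d &
    forall u, u != z -> md (u - z) < d -> md ((f u - f z) / (u - z) - l) < e.
Proof.
rewrite cderivableP; split.
  move=> /cvg_ex[l /= /cvg_md h]; exists l => e /h /near_dnbhs_md[d d0 dP].
  exists d => // u uz ud; have := dP (u - z).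
  rewrite subr_eq0 subr0 => /(_ uz ud).
  by rewrite /GRing.scale /= mulr1 subrK mulrC.
case=> l h; apply/cvg_ex; exists l => /=; apply/cvg_md => e /h[d d0 dP].
apply/near_dnbhs_md; exists d => // u; rewrite subr0 => u0 ud.
have := dP (u + z).
rewrite addrK -subr_eq0 addrK => /(_ u0 ud).
by rewrite /GRing.scale /= mulr1 mulrC.
Qed.

(** The formulation of Caratheodory, in which sums, products and compositions
    of differentiable functions become statements on continuous slopes. *)
Lemma derivable_slope f z : cderivable f z ->
  exists2 phi : cplx R -> cplx R, ccont phi z &
    forall u, f u = f z + phi u * (u - z).
Proof.
move=> /derivable_md[l h].
exists (fun u => if u == z then l else (f u - f z) / (u - z)).
  apply/continuous_md => e e0; have [d d0 dP] := h e e0; exists d => // u ud.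
  rewrite eqxx; case: eqVneq => [_|uz]; first by rewrite subrr md0.
  exact: dP.
move=> u; case: eqVneq => [->|uz]; first by rewrite subrr mulr0 addr0.
by rewrite divfK ?subr_eq0 // addrC subrK.
Qed.

Lemma slope_derive f phi z : ccont phi z ->
  (\forall u \near z, f u = f z + phi u * (u - z)) ->
  cderivable f z /\ derive1 f z = phi z.
Proof.
move=> /continuous_md phic /near_md[d d0 dP].
have slopeE u : u != z -> md (u - z) < d -> (f u - f z) / (u - z) = phi u.
  move=> uz /dP ->; rewrite addrC addKr mulfK //; by rewrite subr_eq0.
split.
  apply/derivable_md; exists (phi z) => e /phic[d' d'0 d'P].
  exists (Num.min d d'); first by rewrite lt_min d0.
  by move=> u uz; rewrite lt_min => /andP[ud ud']; rewrite slopeE //;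
    apply: d'P.
rewrite /derive1; apply: cvg_lim => //.
apply/cvg_md => e /phic[d' d'0 d'P]; apply/near_dnbhs_md.
exists (Num.min d d'); first by rewrite lt_min d0.
move=> u u0; rewrite subr0 lt_min => /andP[ud ud'].
have := slopeE (u + z); rewrite addrK -subr_eq0 addrK => /(_ u0 ud).
rewrite /GRing.scale /= mulrC => ->; apply: d'P; by rewrite addrK.
Qed.

Lemma derivable_near f g z : (\forall u \near z, f u = g u) ->
  cderivable g z -> cderivable f z.
Proof.
move=> fg /derivable_slope[phi phic gE].
apply: (@slope_derive f phi z phic _).1.
have /nbhs_singleton -> := fg.
by apply: filterS fg => u ->; apply: gE.
Qed.

Lemma derivable_continuous f z : cderivable f z -> ccont f z.
Proof.
by move=> /cderivableP/derivable1_diffP; apply: differentiable_continuous.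
Qed.

Lemma derivable_comp1 f g z : cderivable f z -> cderivable g (f z) ->
  cderivable (g \o f) z.
Proof.
move=> df; have fc := derivable_continuous df.
have [phi phic fE] := derivable_slope df.
move=> /derivable_slope[psi psic gE].
apply: (slope_derive (phi := fun u => psi (f u) * phi u) _ _).1.
  exact: continuous_mul (continuous_compose fc psic) phic.
apply/near_md; exists 1 => // u _ /=.
by rewrite (gE (f u)) -mulrA; congr (_ + _ * _); rewrite (fE u) addrC addKr.
Qed.

Lemma derivable_mul f g z : cderivable f z -> cderivable g z ->
  cderivable (fun u => f u * g u) z.
Proof.
by move=> /cderivableP df /cderivableP dg; apply/cderivableP; exact: derivableM.
Qed.

Lemma derivable_inv f z : f z != 0 -> cderivable f z ->
  cderivable (fun u => (f u)^-1) z.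
Proof.
by move=> fz /cderivableP df; apply/cderivableP; exact: derivableV.
Qed.

Lemma derivable_add f g z : cderivable f z -> cderivable g z ->
  cderivable (fun u => f u + g u) z.
Proof.
by move=> /cderivableP df /cderivableP dg; apply/cderivableP; exact: derivableD.
Qed.

Lemma derivable_sub f g z : cderivable f z -> cderivable g z ->
  cderivable (fun u => f u - g u) z.
Proof.
by move=> /cderivableP df /cderivableP dg; apply/cderivableP; exact: derivableB.
Qed.

Lemma derivable_const (c : cplx R) z : cderivable (fun _ => c) z.
Proof. by apply/cderivableP; exact: derivable_cst. Qed.

Lemma derivable_subc z (c : cplx R) : cderivable (fun u => u - c) z.
Proof.
have h : cderivable (fun u : cplx R => u) z.
  by apply/cderivableP; exact: derivable_id.
exact: derivable_sub h (@derivable_const c z).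
Qed.

Lemma derivable_div f g z : g z != 0 -> cderivable f z -> cderivable g z ->
  cderivable (fun u => f u / g u) z.
Proof.
by move=> gz df dg; exact: (@derivable_mul f (fun u =>
  (g u)^-1) z df (derivable_inv gz dg)).
Qed.

Lemma derivable_quot f z (c : cplx R) : z != c -> cderivable f z ->
  cderivable (fun u => (f u - f c) / (u - c)) z.
Proof.
move=> zc df; apply: (@derivable_div (fun u => f u - f c) (fun u => u - c)).
- by rewrite subr_eq0.
- exact: derivable_sub df (@derivable_const (f c) z).
- exact: derivable_subc.
Qed.

End Complex.

(** * Midpoint sums along segments and along squares *)

Section MidpointSums.
Variable R : realType.
Implicit Types (z w u v a b p : cplx R) (f g : cplx R -> cplx R) (x y s h : R).

(** The midpoint sum of f dz over the 2 ^ N equal parts of the segment from a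
    to b. The recursion on halves makes additivity hold by definition. *)
Fixpoint midsum N f a b : cplx R :=
  if N is N'.+1 then midsum N' f a ((a + b) / 2) + midsum N' f ((a + b) / 2) b
  else (b - a) * f ((a + b) / 2).

(** Closure under midpoints is the only convexity that midpoint sums see. *)
Definition midconvex (S : set (cplx R)) :=
  forall a b, S a -> S b -> S ((a + b) / 2).

Lemma natc_neq0 n : n.+1%:R != 0 :> cplx R.
Proof. by rewrite pnatr_eq0. Qed.

Lemma midsum_split N f a b m : m + m = a + b ->
  midsum N.+1 f a b = midsum N f a m + midsum N f m b.
Proof.
move=> mE; suff -> : m = (a + b) / 2 by [].
by have h2 : 2 != 0 :> cplx R by [apply: natc_neq0]; rewrite -mE; field.
Qed.

Lemma midsumB N f g a b :
  midsum N (fun z => f z - g z) a b = midsum N f a b - midsum N g a b.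
Proof.
elim: N a b => [|N IH] a b /=; first by rewrite mulrBr.
by rewrite !IH opprD addrACA.
Qed.

Lemma midsumZ N c f a b : midsum N (fun z => c * f z) a b = c * midsum N f a b.
Proof.
by elim: N a b => [|N IH] a b /=; [rewrite mulrCA | rewrite !IH mulrDr].
Qed.

Lemma midsum_affine N c d a b :
  midsum N (fun z => c + d * z) a b = (b - a) * (c + d * ((a + b) / 2)).
Proof.
elim: N a b => [|N IH] a b //=; rewrite !IH.
have h2 : 2 != 0 :> cplx R by apply: natc_neq0.
by field.
Qed.

Lemma midsum_ext N f g (S : set (cplx R)) a b : midconvex S -> S a -> S b ->
  (forall z, S z -> f z = g z) -> midsum N f a b = midsum N g a b.
Proof.
move=> cS Sa Sb fg; elim: N a b Sa Sb => [|N IH] a b Sa Sb /=.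
  by rewrite fg //; apply: cS.
by congr (_ + _); apply: IH => //; apply: cS.
Qed.

Lemma md_half z : md (z / 2) = md z / 2.
Proof.
rewrite mdM; congr (_ * _); rewrite mdV; congr (_^-1).
by have := md_real (2 : R); rewrite rmorph_nat ger0_norm.
Qed.

Lemma mid_subl a b : (a + b) / 2 - a = (b - a) / 2.
Proof. by have h2 : 2 != 0 :> cplx R by [apply: natc_neq0]; field. Qed.

Lemma mid_subr a b : b - (a + b) / 2 = (b - a) / 2.
Proof. by have h2 : 2 != 0 :> cplx R by [apply: natc_neq0]; field. Qed.

Lemma midsum_bound N f (S : set (cplx R)) a b (K : R) :
  midconvex S -> S a -> S b -> (forall z, S z -> md (f z) <= K) ->
  md (midsum N f a b) <= K * md (b - a).
Proof.
move=> cS Sa Sb fK; elim: N a b Sa Sb => [|N IH] a b Sa Sb /=.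
  rewrite mdM mulrC; apply: ler_wpM2r; first exact: md_ge0.
  by apply: fK; apply: cS.
have Sm := cS _ _ Sa Sb; apply: le_trans (mdD _ _) _.
have := lerD (IH _ _ Sa Sm) (IH _ _ Sm Sb).
by rewrite mid_subl mid_subr md_half; lra.
Qed.

Lemma ReD z w : complex.Re (z + w) = complex.Re z + complex.Re w.
Proof. by case: z w => [? ?] [? ?]. Qed.

Lemma ImD z w : complex.Im (z + w) = complex.Im z + complex.Im w.
Proof. by case: z w => [? ?] [? ?]. Qed.

Lemma mid_double a b : (a + b) / 2 + (a + b) / 2 = a + b.
Proof. by have h2 : 2 != 0 :> cplx R by [apply: natc_neq0]; field. Qed.

Lemma Re_mid a b :
  complex.Re ((a + b) / 2) = (complex.Re a + complex.Re b) / 2.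
Proof.
by have := congr1 (@complex.Re R) (mid_double a b); rewrite !ReD; lra.
Qed.

Lemma Im_mid a b :
  complex.Im ((a + b) / 2) = (complex.Im a + complex.Im b) / 2.
Proof.
by have := congr1 (@complex.Im R) (mid_double a b); rewrite !ImD; lra.
Qed.

Lemma Im_half z : complex.Im (z / 2) = complex.Im z / 2.
Proof. by have := Im_mid z 0; rewrite !addr0. Qed.

(** A lower bound on Im ((b - a) f) is shared equally by the two halves of the
    segment, whose increments are (b - a) / 2. *)
Lemma midsum_Im_ge N f (S : set (cplx R)) a b (K : R) :
  midconvex S -> S a -> S b ->
  (forall z, S z -> K <= complex.Im ((b - a) * f z)) ->
  K <= complex.Im (midsum N f a b).
Proof.
move=> cS Sa Sb; elim: N a b K Sa Sb => [|N IH] a b K Sa Sb fK /=.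
  by apply: fK; apply: cS.
have Sm := cS _ _ Sa Sb; rewrite ImD.
have half z : S z -> K / 2 <= complex.Im ((b - a) / 2 * f z).
  by move=> /fK; rewrite mulrAC Im_half; lra.
have := IH a ((a + b) / 2) (K / 2) Sa Sm; rewrite mid_subl => /(_ half).
have := IH ((a + b) / 2) b (K / 2) Sm Sb; rewrite mid_subr => /(_ half).
lra.
Qed.

Definition rect x1 x2 y1 y2 : set (cplx R) :=
  [set z | [/\ x1 <= complex.Re z, complex.Re z <= x2,
               y1 <= complex.Im z & complex.Im z <= y2]].

Lemma rect_midconvex x1 x2 y1 y2 : midconvex (rect x1 x2 y1 y2).
Proof.
by move=> a b [? ? ? ?] [? ? ? ?]; split; rewrite /= ?Re_mid ?Im_mid; lra.
Qed.

Definition pt x y : cplx R := (x +i* y)%C.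

Lemma ptD x y x' y' : pt x y + pt x' y' = pt (x + x') (y + y').
Proof. by []. Qed.

Lemma md_pt x y : md (pt x y) <= `|x| + `|y|.
Proof. exact: md_le_ReIm. Qed.

(** The midpoint sum of f dz along the border of the square with lower left
    corner (x, y) and side s, counterclockwise; the upper and left sides are
    taken in the direction of the axes and counted negatively. *)
Definition border_sum N f x y s : cplx R :=
  midsum N f (pt x y) (pt (x + s) y)
  + midsum N f (pt (x + s) y) (pt (x + s) (y + s))
  - midsum N f (pt x (y + s)) (pt (x + s) (y + s))
  - midsum N f (pt x y) (pt x (y + s)).

(** Each of the four inner segments belongs to two of the quarters, with
    opposite signs. *)
Lemma border_sum_split N f x y h : border_sum N.+1 f x y (h + h) =
  border_sum N f x y h + border_sum N f (x + h) y h + border_sum N f x (y + h) h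
  + border_sum N f (x + h) (y + h) h.
Proof.
rewrite /border_sum.
rewrite (@midsum_split N f (pt x y) (pt (x + (h + h)) y) (pt (x + h) y));
  last first.
  by rewrite !ptD; congr pt; lra.
rewrite (@midsum_split N f (pt (x + (h + h)) y) _ (pt (x + (h + h)) (y + h)));
  last first.
  by rewrite !ptD; congr pt; lra.
rewrite (@midsum_split N f (pt x (y + (h + h))) _ (pt (x + h) (y + (h + h))));
  last first.
  by rewrite !ptD; congr pt; lra.
rewrite (@midsum_split N f (pt x y) (pt x (y + (h + h))) (pt x (y + h)));
  last first.
  by rewrite !ptD; congr pt; lra.
rewrite !addrA.
move: (midsum N f (pt _ _) (pt _ _)) => A1.
ring.
Qed.

Lemma border_sumB N f g x y s : border_sum N (fun z => f z - g z) x y s =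
  border_sum N f x y s - border_sum N g x y s.
Proof. rewrite /border_sum !midsumB; ring. Qed.

Lemma border_sumZ N c f x y s :
  border_sum N (fun z => c * f z) x y s = c * border_sum N f x y s.
Proof. rewrite /border_sum !midsumZ; ring. Qed.

Lemma border_sum_affine N c d x y s :
  border_sum N (fun z => c + d * z) x y s = 0.
Proof.
have h2 : 2 != 0 :> cplx R by apply: natc_neq0.
rewrite /border_sum !midsum_affine.
have -> : pt (x + s) (y + s) = pt (x + s) y + pt x (y + s) - pt x y.
  by apply/eqP; rewrite eq_complex /=; apply/andP; split; apply/eqP; ring.
by field.
Qed.

Definition square x y s := rect x (x + s) y (y + s).

Definition square_border x y s : set (cplx R) :=
  [set z | [\/ rect x (x + s) y y z, rect (x + s) (x + s) y (y + s) z,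
            rect x (x + s) (y + s) (y + s) z | rect x x y (y + s) z]].

Lemma border_sum_ext N f g x y s : 0 <= s ->
  (forall z, square_border x y s z -> f z = g z) ->
    border_sum N f x y s = border_sum N g x y s.
Proof.
move=> s0 fg; congr (_ + _ - _ - _).
- apply: midsum_ext (@rect_midconvex x (x + s) y y) _ _ _;
    rewrite /rect /= => *.
  + by split; lra.
  + by split; lra.
  + by apply: fg; constructor 1.
- apply: midsum_ext (@rect_midconvex (x + s) (x + s) y (y + s)) _ _ _;
    rewrite /rect /= => *.
  + by split; lra.
  + by split; lra.
  + by apply: fg; constructor 2.
- apply: midsum_ext (@rect_midconvex x (x + s) (y + s) (y + s)) _ _ _;
    rewrite /rect /= => *.
  + by split; lra.
  + by split; lra.
  + by apply: fg; constructor 3.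
- apply: midsum_ext (@rect_midconvex x x y (y + s)) _ _ _;
    rewrite /rect /= => *.
  + by split; lra.
  + by split; lra.
  + by apply: fg; constructor 4.
Qed.

Lemma border_sum_bound N f x y s (K : R) : 0 <= s ->
  (forall z, square_border x y s z -> md (f z) <= K) ->
  md (border_sum N f x y s) <= 4 * (K * s).
Proof.
move=> s0 fK.
have K0 : 0 <= K.
  apply: le_trans (md_ge0 _) (fK (pt x y) _); constructor 1.
  by rewrite /rect /=; split; lra.
have mdh a b : b - a = pt s 0 -> K * md (b - a) <= K * s.
  by move=> ->; apply: ler_wpM2l => //; have := md_pt s 0;
    rewrite normr0 ger0_norm //; lra.
have mdv a b : b - a = pt 0 s -> K * md (b - a) <= K * s.
  by move=> ->; apply: ler_wpM2l => //; have := md_pt 0 s;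
    rewrite normr0 ger0_norm //; lra.
have h1 : md (midsum N f (pt x y) (pt (x + s) y)) <= K * s.
  apply: le_trans (mdh (pt x y) (pt (x + s) y) _); last first.
    by apply/eqP; rewrite eq_complex /=; apply/andP; split; apply/eqP; ring.
  apply: midsum_bound (@rect_midconvex x (x + s) y y) _ _ _;
    rewrite /rect /= => *.
  + by split; lra.
  + by split; lra.
  + by apply: fK; constructor 1.
have h2 : md (midsum N f (pt (x + s) y) (pt (x + s) (y + s))) <= K * s.
  apply: le_trans (mdv (pt (x + s) y) (pt (x + s) (y + s)) _); last first.
    by apply/eqP; rewrite eq_complex /=; apply/andP; split; apply/eqP; ring.
  apply: midsum_bound (@rect_midconvex (x + s) (x + s) y (y + s)) _ _ _;
    rewrite /rect /= => *.
  + by split; lra.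
  + by split; lra.
  + by apply: fK; constructor 2.
have h3 : md (midsum N f (pt x (y + s)) (pt (x + s) (y + s))) <= K * s.
  apply: le_trans (mdh (pt x (y + s)) (pt (x + s) (y + s)) _); last first.
    by apply/eqP; rewrite eq_complex /=; apply/andP; split; apply/eqP; ring.
  apply: midsum_bound (@rect_midconvex x (x + s) (y + s) (y + s)) _ _ _;
    rewrite /rect /= => *.
  + by split; lra.
  + by split; lra.
  + by apply: fK; constructor 3.
have h4 : md (midsum N f (pt x y) (pt x (y + s))) <= K * s.
  apply: le_trans (mdv (pt x y) (pt x (y + s)) _); last first.
    by apply/eqP; rewrite eq_complex /=; apply/andP; split; apply/eqP; ring.
  apply: midsum_bound (@rect_midconvex x x y (y + s)) _ _ _;
    rewrite /rect /= => *.
  + by split; lra.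
  + by split; lra.
  + by apply: fK; constructor 4.
rewrite /border_sum; move: h1 h2 h3 h4.
set A := midsum _ _ _ _; set B := midsum _ _ _ _; set C := midsum _ _ _ _;
  set D := midsum _ _ _ _.
have := mdD (A + B - C) (- D); have := mdD (A + B) (- C); have := mdD A B.
rewrite !mdN; lra.
Qed.

End MidpointSums.

(** * The lemma of Goursat for midpoint sums *)

Section Goursat.
Variable R : realType.
Implicit Types (z w u v a b p : cplx R) (f g : cplx R -> cplx R).
Implicit Types (x y s h e : R) (E : seq (cplx R)).

(** An additive interval function that is at least 1 on every closed interval
    containing c: half of the jump of the sign is counted on each side when c
    is an end point, so nothing is lost when an interval is cut at c. *)
Definition jump x x' c : R := Num.sg (x' - c) - Num.sg (x - c).

Lemma jumpD x x' x'' c : jump x x'' c = jump x x' c + jump x' x'' c.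
Proof. by rewrite /jump; ring. Qed.

Lemma jump_ge0 x x' c : x <= x' -> 0 <= jump x x' c.
Proof.
move=> xx; rewrite /jump.
by case: (sgrP (x - c)) => hx; case: (sgrP (x' - c)) => hx'; lra.
Qed.

Lemma jump_ge1 x x' c : x < x' -> x <= c -> c <= x' -> 1 <= jump x x' c.
Proof.
move=> xx xc cx; rewrite /jump.
by case: (sgrP (x - c)) => hx; case: (sgrP (x' - c)) => hx'; lra.
Qed.

(** The area plus, for each exceptional point, a term that is at least 1 on the
    closed squares containing the point. Being additive, it can replace the
    area in the bisection argument of Goursat. *)
Definition weight (E : seq (cplx R)) x y s : R :=
  s ^+ 2 + \sum_(c <- E)
    jump x (x + s) (complex.Re c) * jump y (y + s) (complex.Im c).

Lemma weight_split E x y h : weight E x y (h + h) =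
  weight E x y h + weight E (x + h) y h + weight E x (y + h) h
  + weight E (x + h) (y + h) h.
Proof.
rewrite /weight; elim: E => [|c E IH]; first by rewrite !big_nil; ring.
move: IH; rewrite !big_cons !addrA.
rewrite (jumpD x (x + h) (x + h + h)) (jumpD y (y + h) (y + h + h)).
lra.
Qed.

Lemma weight_ge E x y s : 0 <= s -> s ^+ 2 <= weight E x y s.
Proof.
move=> s0; rewrite lerDl; apply: sumr_ge0 => c _.
by apply: mulr_ge0; apply: jump_ge0; lra.
Qed.

Lemma weight_ge1 E x y s c : 0 < s -> c \in E -> square x y s c ->
  1 <= weight E x y s.
Proof.
move=> s0 cE [c1 c2 c3 c4]; rewrite /weight (big_rem c) //=.
have : 1 <= jump x (x + s) (complex.Re c) * jump y (y + s) (complex.Im c).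
  by rewrite -[1]mulr1; apply: ler_pM => //; apply: jump_ge1 => //; lra.
have := sqr_ge0 s.
have : 0 <= \sum_(c <- rem c E)
    jump x (x + s) (complex.Re c) * jump y (y + s) (complex.Im c).
  by apply: sumr_ge0 => d _; apply: mulr_ge0; apply: jump_ge0; lra.
lra.
Qed.

Lemma nested_point (a b : nat -> R) : (forall k, a k <= b k) ->
  (forall k, a k <= a k.+1) -> (forall k, b k.+1 <= b k) ->
  exists t, forall k, a k <= t <= b k.
Proof.
move=> ab ai bd.
have aij i j : (i <= j)%N -> a i <= a j.
  elim: j => [|j IH]; first by rewrite leqn0 => /eqP ->.
  by rewrite leq_eqVlt => /orP[/eqP->//|/IH h]; apply: le_trans h _.
have bij i j : (i <= j)%N -> b j <= b i.
  elim: j => [|j IH]; first by rewrite leqn0 => /eqP ->.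
  by rewrite leq_eqVlt => /orP[/eqP->//|/IH h]; apply: le_trans _ h.
have abij i j : a i <= b j.
  case: (leqP i j) => [ij|/ltnW ij]; first exact: le_trans (aij _ _ ij) _.
  by apply: le_trans (ab _) _; apply: bij.
have hs : has_sup (range a).
  by split; [exists (a 0%N); exists 0%N | exists (b 0%N) => _ [i _ <-]].
exists (sup (range a)) => k; apply/andP; split.
  by apply: sup_upper_bound => //; exists k.
by apply: ge_sup => [|_ [i _ <-]//]; exists (a 0%N); exists 0%N.
Qed.

Lemma halving_lt (s d : R) : 0 < s -> 0 < d -> exists k, s / 2 ^+ k < d.
Proof.
move=> s0 d0; have sd : 0 <= s / d by apply: divr_ge0; lra.
have := archi_boundP sd; set k := Num.bound _ => hk; exists k.
have h2 : (k%:R : R) < 2 ^+ k.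
  by rewrite -natrX ltr_nat; apply: ltn_expl.
have p2 : 0 < 2 ^+ k :> R by apply: exprn_gt0.
rewrite ltr_pdivrMr //.
by move: hk; rewrite ltr_pdivrMr // => hk; apply: lt_le_trans hk _;
  rewrite mulrC ler_pM2l //; lra.
Qed.

Definition border_small f (E : seq (cplx R)) e x y s :=
  exists N0, forall N, (N0 <= N)%N ->
    md (border_sum N f x y s) <= e * weight E x y s.

Lemma border_small_split f E e x y h :
  border_small f E e x y h -> border_small f E e (x + h) y h ->
  border_small f E e x (y + h) h -> border_small f E e (x + h) (y + h) h ->
  border_small f E e x y (h + h).
Proof.
move=> [N1 h1] [N2 h2] [N3 h3] [N4 h4].
exists (maxn (maxn N1 N2) (maxn N3 N4)).+1 => -[//|N].
rewrite ltnS !geq_max => /andP[/andP[n1 n2] /andP[n3 n4]].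
rewrite border_sum_split weight_split.
move: (h1 _ n1) (h2 _ n2) (h3 _ n3) (h4 _ n4).
set A := border_sum _ _ _ _ _; set B := border_sum _ _ _ _ _;
  set C := border_sum _ _ _ _ _; set D := border_sum _ _ _ _ _.
have := mdD (A + B + C) D; have := mdD (A + B) C; have := mdD A B.
rewrite !mulrDr; lra.
Qed.

Lemma border_small_step f E e (q : R * R * R) : exists q' : R * R * R,
  ~ border_small f E e q.1.1 q.1.2 q.2 ->
  [/\ ~ border_small f E e q'.1.1 q'.1.2 q'.2, q'.2 = q.2 / 2,
      q'.1.1 = q.1.1 \/ q'.1.1 = q.1.1 + q.2 / 2 &
      q'.1.2 = q.1.2 \/ q'.1.2 = q.1.2 + q.2 / 2].
Proof.
case: q => -[x y] s /=; set h := s / 2.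
have -> : s = h + h by rewrite /h; lra.
have [h1|h1] := pselect (border_small f E e x y h); last first.
  by exists (x, y, h); split=> //=; auto.
have [h2|h2] := pselect (border_small f E e (x + h) y h); last first.
  by exists (x + h, y, h); split=> //=; auto.
have [h3|h3] := pselect (border_small f E e x (y + h) h); last first.
  by exists (x, y + h, h); split=> //=; auto.
have [h4|h4] := pselect (border_small f E e (x + h) (y + h) h); last first.
  by exists (x + h, y + h, h); split=> //=; auto.
by exists (x, y, h) => ns; case: ns; apply: border_small_split.
Qed.

(** Near a point t of differentiability f is affine up to o(|z - t|); affine
    functions do not contribute, and a border of length 4 s carries an error
    o(s), in all o(s ^ 2). *)
Lemma border_small_at_derivable f E e t : 0 < e -> cderivable f t ->
  exists2 d, 0 < d & forall x y s, 0 < s -> s < d -> square x y s t ->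
    border_small f E e x y s.
Proof.
move=> e0 /derivable_md[l h].
have e8 : 0 < e / 8 by lra.
have [d d0 dP] := h _ e8; exists (d / 2); first by lra.
move=> x y s s0 sd [t1 t2 t3 t4]; exists 0%N => N _.
have fE : forall z, square x y s z ->
    md (f z - ((f t - l * t) + l * z)) <= e / 8 * (2 * s).
  move=> z [z1 z2 z3 z4].
  have zt : md (z - t) <= 2 * s.
    apply: le_trans (md_le_ReIm _) _.
    have -> : complex.Re (z - t) = complex.Re z - complex.Re t
      by case: (z) (t) => [? ?] [? ?].
    have -> : complex.Im (z - t) = complex.Im z - complex.Im t
      by case: (z) (t) => [? ?] [? ?].
    have : `|complex.Re z - complex.Re t| <= s by rewrite ler_norml; lra.
    have : `|complex.Im z - complex.Im t| <= s by rewrite ler_norml; lra.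
    lra.
  have [->|nzt] := eqVneq z t.
    have -> : f t - (f t - l * t + l * t) = 0 by ring.
    by rewrite md0; apply: mulr_ge0; lra.
  have -> : f z - ((f t - l * t) + l * z) =
      ((f z - f t) / (z - t) - l) * (z - t).
    have nzt0 : z - t != 0 by rewrite subr_eq0.
    by field.
  rewrite mdM; apply: ler_pM => //; try exact: md_ge0.
  by apply: ltW; apply: dP => //; lra.
have bdE : border_sum N f x y s = border_sum N (fun z =>
  f z - ((f t - l * t) + l * z)) x y s.
  by rewrite border_sumB border_sum_affine subr0.
have : md (border_sum N f x y s) <= 4 * (e / 8 * (2 * s) * s).
  rewrite bdE; apply: border_sum_bound; first exact: ltW.
  move=> z [] [? ? ? ?]; apply: fE; split; lra.
have : e * s ^+ 2 <= e * weight E x y s.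
  by apply: ler_wpM2l; [exact: ltW | apply: weight_ge; exact: ltW].
rewrite expr2; lra.
Qed.

(** The border sum is at most 4 M s, while the weight stays at least 1. *)
Lemma border_small_at_exception f (E : seq (cplx R)) e (M : R) t : 0 < e ->
  0 <= M ->
  t \in E ->
  exists2 d, 0 < d & forall x y s, 0 < s -> s < d -> square x y s t ->
    (forall z, square x y s z -> md (f z) <= M) -> border_small f E e x y s.
Proof.
move=> e0 M0 tE; exists (e / (4 * (M + 1))); first by apply: divr_gt0; lra.
move=> x y s s0 sd st fM; exists 0%N => N _.
have hM : 4 * (M * s) <= e.
  move: sd; rewrite ltr_pdivlMr; last lra.
  lra.
have h1 : md (border_sum N f x y s) <= 4 * (M * s).
  apply: border_sum_bound; first exact: ltW.
  by move=> z [] [? ? ? ?]; apply: fM; split; lra.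
have h2 : e * 1 <= e * weight E x y s.
  by apply: ler_wpM2l; [exact: ltW | apply: weight_ge1 st].
lra.
Qed.

(** If the bound failed for the square it would fail for one of its quarters,
    and so on; the nested squares shrink to a point at which one of the two
    preceding lemmas applies. *)
Lemma goursat f E x y s (M : R) e : 0 < s -> 0 < e ->
  (forall z, square x y s z -> md (f z) <= M) ->
  (forall z, square x y s z -> z \notin E -> cderivable f z) ->
  exists N0, forall N, (N0 <= N)%N -> md (border_sum N f x y s) <= e.
Proof.
move=> s0 e0 fM fd.
have M0 : 0 <= M by apply: le_trans (md_ge0 _) (fM (pt x y) _); split=> /=; lra.
suff H : forall e', 0 < e' -> border_small f E e' x y s.
  have W0 : 0 < weight E x y s.
    apply: lt_le_trans (weight_ge E x y (ltW s0)); exact: exprn_gt0.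
  have [|N0 hN] := H (e / weight E x y s); first exact: divr_gt0.
  exists N0 => N /hN; by rewrite divfK // gt_eqF.
move=> {e0} {}e e0; apply: contrapT => ns.
have [nxt nxtP] := choice (border_small_step f E e).
pose q k := iter k nxt (x, y, s).
have nsq k : ~ border_small f E e (q k).1.1 (q k).1.2 (q k).2.
  by elim: k => [//|k IH] /=; have [] := nxtP _ IH.
have qS k : [/\ (q k.+1).2 = (q k).2 / 2,
    (q k.+1).1.1 = (q k).1.1 \/ (q k.+1).1.1 = (q k).1.1 + (q k).2 / 2 &
    (q k.+1).1.2 = (q k).1.2 \/ (q k.+1).1.2 = (q k).1.2 + (q k).2 / 2].
  by have [] := nxtP _ (nsq k).
have qs k : (q k).2 = s / 2 ^+ k.
  elim: k => [|k IH]; first by rewrite expr0 divr1.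
  by have [-> _ _] := qS k; rewrite IH exprSr invfM mulrA.
have qs0 k : 0 < (q k).2 by rewrite qs; apply: divr_gt0 => //; apply: exprn_gt0.
have [tx txP] : exists t, forall k, (q k).1.1 <= t <= (q k).1.1 + (q k).2.
  by apply: nested_point => k; have := qs0 k; have [e1 [] e2 _] := qS k; lra.
have [ty tyP] : exists t, forall k, (q k).1.2 <= t <= (q k).1.2 + (q k).2.
  by apply: nested_point => k; have := qs0 k; have [e1 _ [] e2] := qS k; lra.
pose t := pt tx ty.
have tq k : square (q k).1.1 (q k).1.2 (q k).2 t.
  by have /andP[? ?] := txP k; have /andP[? ?] := tyP k; split.
have sub k z : square (q k).1.1 (q k).1.2 (q k).2 z -> square x y s z.
  elim: k => [//|k IH] [z1 z2 z3 z4]; apply: IH; move: z1 z2 z3 z4.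
  by have := qs0 k; have [e1 [] e2 [] e3] := qS k => ? ? ? ? ?; split; lra.
have [d d0 dP] : exists2 d, 0 < d & forall x' y' s', 0 < s' -> s' < d ->
    square x' y' s' t -> (forall z, square x' y' s' z -> md (f z) <= M) ->
    border_small f E e x' y' s'.
  have [tE|tE] := boolP (t \in E); first exact: border_small_at_exception.
  have dt := fd _ (tq 0%N) tE.
  have [d d0 dP] := border_small_at_derivable E e0 dt.
  by exists d => // x' y' s' ? ? ? _; apply: dP.
have [k hk] := halving_lt s0 d0.
apply: (nsq k); apply: dP => //; first by rewrite qs.
by move=> z /sub; apply: fM.
Qed.

Definition sq_around c (r : R) : set (cplx R) :=
  square (complex.Re c - r) (complex.Im c - r) (r + r).

Definition border_around c (r : R) : set (cplx R) :=
  square_border (complex.Re c - r) (complex.Im c - r) (r + r).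

Lemma ReB z w : complex.Re (z - w) = complex.Re z - complex.Re w.
Proof. by case: z w => [? ?] [? ?]. Qed.

Lemma ImB z w : complex.Im (z - w) = complex.Im z - complex.Im w.
Proof. by case: z w => [? ?] [? ?]. Qed.

Lemma border_around_ge c r z : 0 < r -> border_around c r z -> r <= md (z - c).
Proof.
move=> r0; have hr := Re_le_md (z - c); have hi := Im_le_md (z - c).
move: hr hi; rewrite ReB ImB => hr hi.
have l1 := ler_norm (complex.Re z - complex.Re c).
have l2 := ler_norm (complex.Im z - complex.Im c).
have l3 := ler_norm (- (complex.Re z - complex.Re c)).
have l4 := ler_norm (- (complex.Im z - complex.Im c)).
rewrite !normrN in l3 l4.
by move=> [] [? ? ? ?]; lra.
Qed.

Lemma sq_around_le c r z : sq_around c r z -> md (z - c) <= 2 * r.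
Proof.
move=> [? ? ? ?]; apply: le_trans (md_le_ReIm _) _; rewrite ReB ImB.
have : `|complex.Re z - complex.Re c| <= r by rewrite ler_norml; lra.
have : `|complex.Im z - complex.Im c| <= r by rewrite ler_norml; lra.
lra.
Qed.

Lemma border_sub c r z : 0 < r -> border_around c r z -> sq_around c r z.
Proof. by move=> r0 [] [? ? ? ?]; split; lra. Qed.

(** The imaginary part of w / q is (Im w Re q - Re w Im q) / |q| ^ 2. *)
Lemma Im_quot_ge (w q : cplx R) :
  complex.Re q ^+ 2 + complex.Im q ^+ 2 <=
    complex.Im w * complex.Re q - complex.Re w * complex.Im q ->
  0 < complex.Re q ^+ 2 + complex.Im q ^+ 2 ->
  1 <= complex.Im (w * q^-1).
Proof.
case: w q => [A B] [a b] /= h n0.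
have -> : A * - (b / (a ^+ 2 + b ^+ 2)) + B * (a / (a ^+ 2 + b ^+ 2)) =
  (B * a - A * b) / (a ^+ 2 + b ^+ 2) by field; rewrite gt_eqF.
by rewrite ler_pdivlMr // mul1r.
Qed.

(** The integral is 2 pi i; the lower bound 4 is enough and is obtained side by
    side, each side contributing at least 2 r * r / (r ^ 2 + r ^ 2) = 1. *)
Lemma winding_ge N c r : 0 < r ->
  4 <= complex.Im (border_sum N (fun z => (z - c)^-1)
                     (complex.Re c - r) (complex.Im c - r) (r + r)).
Proof.
case: c => cx cy r0 /=; set c : cplx R := (cx +i* cy)%C.
have sq t : - r <= t -> t <= r -> t ^+ 2 <= r ^+ 2.
  move=> h1 h2; have : 0 <= (r - t) * (r + t) by apply: mulr_ge0; lra.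
  by rewrite !expr2; lra.
have side (k A B x1 x2 y1 y2 : R) (p q : cplx R) :
    rect x1 x2 y1 y2 p -> rect x1 x2 y1 y2 q -> q - p = pt A B ->
    (forall z, rect x1 x2 y1 y2 z ->
      (complex.Re z - cx) ^+ 2 + (complex.Im z - cy) ^+ 2 <=
        k * (B * (complex.Re z - cx) - A * (complex.Im z - cy)) /\
      0 < (complex.Re z - cx) ^+ 2 + (complex.Im z - cy) ^+ 2) ->
    1 <= complex.Im ((k%:C)%C * midsum N (fun z => (z - c)^-1) p q).
  move=> Sp Sq qp h; rewrite -midsumZ;
    apply: midsum_Im_ge (@rect_midconvex _ x1 x2 y1 y2) Sp Sq _.
  move=> z /h[h1 h2]; rewrite qp mulrA.
  apply: Im_quot_ge => //; rewrite ReB ImB //=.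
  by move: h1; lra.
(* The sign of the upper and left sides is written as a real scalar, in order
   to apply side to all four sides. *)
pose kk : cplx R := ((-1)%:C)%C.
have kkE : kk = -1 by rewrite /kk rmorphN1.
have r2 : 0 < r ^+ 2 by apply: exprn_gt0.
rewrite /border_sum -![- midsum _ _ _ _]mulN1r -kkE !ImD.
have s1 : 1 <= complex.Im ((1%:C)%C * midsum N (fun z => (z - c)^-1)
    (pt (cx - r) (cy - r)) (pt (cx - r + (r + r)) (cy - r))).
  apply: (side 1 (r + r) 0 (cx - r) (cx - r + (r + r)) (cy - r) (cy - r)).
  - by split=> /=; lra.
  - by split=> /=; lra.
  - by apply/eqP; rewrite eq_complex /=; apply/andP; split; apply/eqP; ring.
  - move=> z [z1 z2 z3 z4]; have -> : complex.Im z - cy = - r by lra.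
    have := sq (complex.Re z - cx); have := sqr_ge0 (complex.Re z - cx).
    rewrite sqrrN => ? hs; have {}hs : (complex.Re z - cx) ^+ 2 <= r ^+ 2
      by apply: hs; lra.
    by split; lra.
have s2 : 1 <= complex.Im ((1%:C)%C * midsum N (fun z => (z - c)^-1)
    (pt (cx - r + (r + r)) (cy - r))
    (pt (cx - r + (r + r)) (cy - r + (r + r)))).
  apply: (side 1 0 (r + r) (cx - r + (r + r)) (cx - r + (r + r))
    (cy - r) (cy - r + (r + r))).
  - by split=> /=; lra.
  - by split=> /=; lra.
  - by apply/eqP; rewrite eq_complex /=; apply/andP; split; apply/eqP; ring.
  - move=> z [z1 z2 z3 z4]; have -> : complex.Re z - cx = r by lra.
    have := sq (complex.Im z - cy); have := sqr_ge0 (complex.Im z - cy).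
    move=> ? hs; have {}hs : (complex.Im z - cy) ^+ 2 <= r ^+ 2
      by apply: hs; lra.
    by split; lra.
have s3 : 1 <= complex.Im (((-1)%:C)%C * midsum N (fun z => (z - c)^-1)
    (pt (cx - r) (cy - r + (r + r)))
    (pt (cx - r + (r + r)) (cy - r + (r + r)))).
  apply: (side (-1) (r + r) 0 (cx - r) (cx - r + (r + r))
    (cy - r + (r + r)) (cy - r + (r + r))).
  - by split=> /=; lra.
  - by split=> /=; lra.
  - by apply/eqP; rewrite eq_complex /=; apply/andP; split; apply/eqP; ring.
  - move=> z [z1 z2 z3 z4]; have -> : complex.Im z - cy = r by lra.
    have := sq (complex.Re z - cx); have := sqr_ge0 (complex.Re z - cx).
    move=> ? hs; have {}hs : (complex.Re z - cx) ^+ 2 <= r ^+ 2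
      by apply: hs; lra.
    by split; lra.
have s4 : 1 <= complex.Im (((-1)%:C)%C * midsum N (fun z => (z - c)^-1)
    (pt (cx - r) (cy - r)) (pt (cx - r) (cy - r + (r + r)))).
  apply: (side (-1) 0 (r + r) (cx - r) (cx - r) (cy - r) (cy - r + (r + r))).
  - by split=> /=; lra.
  - by split=> /=; lra.
  - by apply/eqP; rewrite eq_complex /=; apply/andP; split; apply/eqP; ring.
  - move=> z [z1 z2 z3 z4]; have -> : complex.Re z - cx = - r by lra.
    have := sq (complex.Im z - cy); have := sqr_ge0 (complex.Im z - cy).
    rewrite sqrrN => ? hs; have {}hs : (complex.Im z - cy) ^+ 2 <= r ^+ 2
      by apply: hs; lra.
    by split; lra.
rewrite !mul1r in s1 s2; move: s1 s2 s3 s4; rewrite /kk; lra.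
Qed.

Lemma quot_bounded f c (S : set (cplx R)) (M : R) : cderivable f c -> S c ->
  (forall z, S z -> md (f z) <= M) ->
  exists M' : R, forall z, S z -> md ((f z - f c) / (z - c)) <= M'.
Proof.
move=> /derivable_md[l /(_ 1 ltr01)[d d0 dP]] Sc fM.
exists (Num.max (md l + 1) (2 * M / d)) => z Sz; rewrite le_max.
have [->|zc] := eqVneq z c.
  by rewrite !subrr mul0r md0; apply/orP; left; have := md_ge0 l; lra.
case: (ltP (md (z - c)) d) => zd; apply/orP; [left|right].
  by have := dP _ zc zd; have := mdB_ge ((f z - f c) / (z - c)) l; lra.
rewrite mdM mdV; apply: ler_pM; rewrite ?md_ge0 ?invr_ge0 ?md_ge0 //.
  by have := mdD (f z) (- f c); have := fM _ Sz; have := fM _ Sc; rewrite mdN;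
    lra.
by rewrite lef_pV2 // posrE //; lra.
Qed.

(** A weak maximum principle. The border sums of (f z - f c) / (z - c) tend to
    0, so those of f z / (z - c), at most 8 K, approach f c times those of 1 /
    (z - c), which are at least 4. The set E contains the points where f is
    only known to be bounded. *)
Lemma md_center_le f E c r (M K : R) : 0 < r ->
  (forall z, sq_around c r z -> md (f z) <= M) ->
  (forall z, sq_around c r z -> z \notin E -> cderivable f z) ->
  c \notin E -> (forall z, border_around c r z -> md (f z) <= K) ->
  md (f c) <= 2 * K.
Proof.
move=> r0 fM fd cE fK.
have sc : sq_around c r c by split; lra.
have M0 : 0 <= M by apply: le_trans (md_ge0 _) (fM c sc).
pose q z := (f z - f c) / (z - c).
have [M' qM] := quot_bounded (fd _ sc cE) sc fM.
have qd z : sq_around c r z -> z \notin c :: E -> cderivable q z.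
  move=> sz; rewrite inE negb_or => /andP[zc zE].
  by apply: derivable_quot => //; apply: fd.
apply/ler_addgt0Pr => e e0.
have rr : 0 < r + r by lra.
have e4 : 0 < 4 * e by lra.
have [N0 /(_ N0 (leqnn _))] := goursat rr e4 qM qd.
pose F z := f z / (z - c).
pose G z := (z - c)^-1.
have -> : border_sum N0 q (complex.Re c - r) (complex.Im c - r) (r + r) =
    border_sum N0 F (complex.Re c - r) (complex.Im c - r) (r + r) -
    f c * border_sum N0 G (complex.Re c - r) (complex.Im c - r) (r + r).
  rewrite -border_sumZ -border_sumB; apply: border_sum_ext; first exact: ltW.
  by move=> z _; rewrite /q /F /G mulrBl.
have FK : md (border_sum N0 F (complex.Re c - r) (complex.Im c - r) (r + r)) <=
    4 * (K / r * (r + r)).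
  apply: border_sum_bound; first exact: ltW.
  move=> z bz; rewrite /F mdM mdV.
  have zr := border_around_ge r0 bz.
  apply: ler_pM; rewrite ?invr_ge0 ?md_ge0 //; first exact: fK.
  by rewrite lef_pV2 // posrE //; lra.
have := winding_ge N0 c r0; rewrite -/G.
move: FK; set A := border_sum _ _ _ _ _;
  set B := border_sum _ _ _ _ _ => FK hB hAB.
have B4 : 4 <= md B by apply: le_trans hB (le_trans (ler_norm _) (Im_le_md _)).
have h1 : md (f c) * 4 <= md (f c) * md B
  by apply: ler_wpM2l => //; apply: md_ge0.
have h2 := mdB_ge (f c * B) A; rewrite mdBC in h2; rewrite mdM in h2.
have h3 : K / r * (r + r) = 2 * K by field; rewrite gt_eqF.
rewrite h3 in FK; lra.
Qed.

End Goursat.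

(** * Removable singularities and isolated zeros *)

Section Holomorphic.
Variable R : realType.
Implicit Types (z w u v a b c : cplx R) (f g : cplx R -> cplx R) (r e : R).

(** For u near c the quotient (f z - f u) / (z - u) is bounded near u and c and
    differentiable elsewhere, so the weak maximum principle at v, with
    exceptions u and c, bounds it by its size on the border of a fixed square
    around v. *)
Lemma removable_lipschitz f c (rho M : R) : 0 < rho ->
  (forall z, z != c -> md (z - c) < rho -> md (f z) <= M /\ cderivable f z) ->
  exists2 K : R, 0 <= K & forall u v, u != c -> v != c ->
    md (u - c) < rho / 8 -> md (v - c) < rho / 8 ->
    md (f u - f v) <= K * md (u - v).
Proof.
move=> rho0 fP; pose M0 := Num.max (md (f c)) M.
have fM z : md (z - c) < rho -> md (f z) <= M0.
  by rewrite /M0 le_max; have [->|zc] := eqVneq z c;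
    [rewrite lexx | move=> /(fP _ zc)[-> _]; rewrite orbT].
have M00 : 0 <= M0 by rewrite le_max md_ge0.
pose K := 2 * (2 * M0 / (rho / 8)).
have K0 : 0 <= K by rewrite /K; apply: mulr_ge0 => //; apply: divr_ge0; lra.
exists K => // u v uc vc ur vr.
have [->|uv] := eqVneq u v; first by rewrite !subrr md0 mulr0.
pose q z := (f z - f u) / (z - u).
(* A square of half side 3/8 rho around v stays in the disk of radius rho
   around c, and its border stays at distance rho / 8 from u. *)
have r0 : 0 < 3 / 8 * rho by lra.
have sqc z : sq_around v (3 / 8 * rho) z -> md (z - c) < rho.
  move=> /sq_around_le h; have := mdD (z - v) (v - c).
  by rewrite addrA subrK; lra.
have du : cderivable f u by apply: (fP _ uc _).2; lra.
have [||M' qM'] := @quot_bounded R f u [set z | md (z - c) < rho] M0 du.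
- by rewrite /=; lra.
- by move=> z; apply: fM.
have : md (q v) <= K.
  apply: (@md_center_le R q [:: u; c] v _ M' _ r0).
  - by move=> z /sqc; apply: qM'.
  - move=> z sz; rewrite !inE negb_or => /andP[zu zc].
    by apply: derivable_quot => //; apply: (fP _ zc _).2; apply: sqc.
  - by rewrite !inE negb_or vc andbT eq_sym.
  move=> z bz; rewrite /q mdM mdV.
  have sz := border_sub r0 bz; have zr := border_around_ge r0 bz.
  have zu : rho / 8 <= md (z - u).
    have := mdD (z - u) (u - v); rewrite addrA subrK.
    have := mdD (u - c) (c - v); rewrite addrA subrK [md (c - v)]mdBC.
    by lra.
  apply: ler_pM; rewrite ?md_ge0 ?invr_ge0 ?md_ge0 //.
    have := mdD (f z) (- f u); rewrite mdN; have := fM z (sqc _ sz).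
    have : md (f u) <= M0 by apply: fM; lra.
    by lra.
  by rewrite lef_pV2 // posrE; lra.
have vu0 : v - u != 0 by rewrite subr_eq0 eq_sym.
have -> : f u - f v = q v * (u - v) by rewrite /q; field.
by rewrite mdM => h; apply: ler_wpM2r => //; apply: md_ge0.
Qed.

(** The limit at c is the supremum of phi z - K |z - c|, as these lower bounds
    never exceed the upper bounds phi w + K |w - c|. *)
Lemma lipschitz_real_limit (phi : cplx R -> R) c (r K : R) : 0 < r -> 0 <= K ->
  (forall u v, u != c -> v != c -> md (u - c) < r -> md (v - c) < r ->
     `|phi u - phi v| <= K * md (u - v)) ->
  exists L, forall z, z != c -> md (z - c) < r ->
    `|phi z - L| <= K * md (z - c).
Proof.
move=> r0 K0 h.
pose S := [set y | exists2 z, z != c /\ md (z - c) < r & y =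
  phi z - K * md (z - c)].
have key z w : z != c -> md (z - c) < r -> w != c -> md (w - c) < r ->
    phi z - K * md (z - c) <= phi w + K * md (w - c).
  move=> zc zr wc wr; have := h _ _ zc wc zr wr.
  have := mdD (z - c) (c - w); rewrite addrA subrK [md (c - w)]mdBC => t.
  have : K * md (z - w) <= K * (md (z - c) + md (w - c)) by apply: ler_wpM2l.
  by have := ler_norm (phi z - phi w); lra.
have [z0 [z0c z0r]] : exists z0, z0 != c /\ md (z0 - c) < r.
  exists (c + ((r / 2)%:C)%C);
    rewrite -subr_eq0 [c + _]addrC addrK -md_eq0 md_real.
  by rewrite ger0_norm; [split; [rewrite gt_eqF|]; lra|lra].
have Sb z : z != c -> md (z - c) < r -> ubound S (phi z + K * md (z - c)).
  by move=> zc zr _ [w [wc wr] ->]; apply: key.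
have S0 : S !=set0 by exists (phi z0 - K * md (z0 - c)); exists z0.
have hS : has_sup S by split => //; exists (phi z0 + K * md (z0 - c));
  apply: Sb.
exists (sup S) => z zc zr.
have h1 : phi z - K * md (z - c) <= sup S.
  by apply: sup_upper_bound => //; exists z.
have h2 : sup S <= phi z + K * md (z - c) by apply: ge_sup => //; apply: Sb.
by rewrite ler_norml; lra.
Qed.

Lemma removable_limit f c (rho M : R) : 0 < rho ->
  (forall z, z != c -> md (z - c) < rho -> md (f z) <= M /\ cderivable f z) ->
  exists L, exists2 K : R, 0 <= K & forall z, z != c -> md (z - c) < rho / 8 ->
    md (f z - L) <= K * md (z - c).
Proof.
move=> rho0 fP; have [K K0 lip] := removable_lipschitz rho0 fP.
have r0 : 0 < rho / 8 by lra.
have [L1 L1P] : exists L, forall z, z != c -> md (z - c) < rho / 8 ->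
    `|complex.Re (f z) - L| <= K * md (z - c).
  apply: lipschitz_real_limit => // u v uc vc ur vr.
  by rewrite -ReB; apply: le_trans (Re_le_md _) (lip _ _ uc vc ur vr).
have [L2 L2P] : exists L, forall z, z != c -> md (z - c) < rho / 8 ->
    `|complex.Im (f z) - L| <= K * md (z - c).
  apply: lipschitz_real_limit => // u v uc vc ur vr.
  by rewrite -ImB; apply: le_trans (Im_le_md _) (lip _ _ uc vc ur vr).
exists (pt L1 L2); exists (2 * K); first lra.
move=> z zc zr; apply: le_trans (md_le_ReIm _) _; rewrite ReB ImB.
by have := L1P z zc zr; have := L2P z zc zr; rewrite /=; lra.
Qed.

(** The preceding lemma gives a limit L at c with f z - L = O(|z - c|); it
    applies once more to the bounded quotient (f z - L) / (z - c), whose limit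
    is the derivative. *)
Lemma removable f c (rho M : R) : 0 < rho ->
  (forall z, z != c -> md (z - c) < rho -> md (f z) <= M /\ cderivable f z) ->
  exists L, cderivable (fun z => if z == c then L else f z) c.
Proof.
move=> rho0 fP; have [L [K K0 LP]] := removable_limit rho0 fP.
pose q z := (f z - L) / (z - c).
have [|z zc zr|L1 [K1 K10 L1P]] := @removable_limit q c (rho / 8) K; first lra.
  split.
    rewrite /q mdM mdV ler_pdivrMr; last by rewrite md_gt0 subr_eq0.
    exact: LP.
  have zc0 : z - c != 0 by rewrite subr_eq0.
  have dz : cderivable f z by apply: (fP _ zc _).2; lra.
  apply: (@derivable_div _ (fun z => f z - L) (fun z => z - c) z zc0).
    exact: derivable_sub dz (@derivable_const _ L z).
  exact: derivable_subc.
exists L.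
apply: (@slope_derive R _ (fun z => if z == c then L1 else q z) c _ _).1.
  apply/continuous_md => e e0; exists (Num.min (rho / 8 / 8) (e / (K1 + 1))).
    by rewrite lt_min; apply/andP; split; [lra | apply: divr_gt0; lra].
  move=> u; rewrite eqxx lt_min => /andP[ur ue].
  case: eqVneq => [_|uc]; first by rewrite subrr md0.
  apply: le_lt_trans (L1P _ uc ur) _.
  move: ue; rewrite ltr_pdivlMr; last lra.
  by have := md_ge0 (u - c); lra.
apply/near_md; exists 1 => // u _; rewrite eqxx.
case: eqVneq => [->|uc]; first by rewrite subrr mulr0 addr0.
have uc0 : u - c != 0 by rewrite subr_eq0.
by rewrite /q; field.
Qed.

Lemma HinftyP f : Hinfty f <-> (forall z, md z < 1 -> cderivable f z) /\
  exists M : R, forall z, md z < 1 -> md (f z) <= M.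
Proof.
split.
  case=> hf [M0 [_ /(_ (M0 + 1))]]; rewrite ltrDl ltr01 => /(_ isT) bf.
  split; first by move=> z /unit_diskE/hf/cderivableP.
  exists (complex.Re (M0 + 1)) => z /unit_diskE z1.
  have : ((md (f z))%:C)%C <= M0 + 1 :> R[i] := bf z z1.
  by rewrite lecE => /andP[].
case=> hf [M fM]; split; first by move=> z /unit_diskE/hf/cderivableP.
exists ((M%:C)%C); split; first by rewrite complex_real.
move=> x Mx z /unit_diskE /fM h; apply: le_trans (ltW Mx).
by rewrite mdE lecR.
Qed.

Lemma divide_root f c : Hinfty f -> md c < 1 -> f c = 0 ->
  exists2 g, Hinfty g & forall z, f z = (z - c) * g z.
Proof.
move=> /HinftyP[fd [M fM]] c1 fc.
have [||M' qM] := @quot_bounded R f c [set z | md z < 1] M (fd _ c1) => //.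
pose q z := (f z - f c) / (z - c).
have qd z : z != c -> md z < 1 -> cderivable q z.
  by move=> zc z1; apply: derivable_quot => //; apply: fd.
have r0 : 0 < 1 - md c by lra.
have [|L LP] := @removable q c _ M' r0.
  move=> z zc zr; have z1 : md z < 1.
    by have := mdD (z - c) c; rewrite subrK; lra.
  by split; [apply: qM | apply: qd].
pose g z := if z == c then L else q z.
exists g; last first.
  move=> z; rewrite /g /q fc subr0; case: eqVneq => [->|zc].
    by rewrite fc subrr mul0r.
  by rewrite mulrC divfK // subr_eq0.
apply/HinftyP; split.
  move=> z z1; have [->//|zc] := eqVneq z c.
  apply: derivable_near (qd _ zc z1); apply/near_md.
  exists (md (z - c)); first by rewrite md_gt0 subr_eq0.
  move=> u uz; rewrite /g; case: eqVneq => // uc.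
  by move: uz; rewrite uc mdBC ltxx.
exists (Num.max (md L) M') => z z1; rewrite le_max /g.
by case: eqVneq => [_|_]; [rewrite lexx | rewrite orbC; rewrite qM].
Qed.

(** A zero of infinite order, with quotients in the class of bounded
    holomorphic functions. *)
Definition flat f c := forall m, exists2 h, Hinfty h &
  forall z, f z = (z - c) ^+ m * h z.

Lemma isolated_or_flat f c : Hinfty f -> md c < 1 ->
  (\forall z \near c^', f z != 0) \/ flat f c.
Proof.
move=> hf c1; have [|ni] := pselect (\forall z \near c^', f z != 0); first
  by left.
right; elim=> [|m [h hh fE]]; first by exists f => // z; rewrite expr0 mul1r.
have [hc|hc] := eqVneq (h c) 0; last first.
  exfalso; apply: ni.
  have [hd _] := (HinftyP h).1 hh.
  have /near_md[d d0 dP] := continuous_neq0 (derivable_continuous (hd _ c1)) hc.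
  apply/near_dnbhs_md; exists d => // u uc /dP hu.
  by rewrite fE mulf_neq0 // expf_neq0 // subr_eq0.
have [g hg gE] := divide_root hh c1 hc; exists g => // z.
by rewrite fE gE mulrA exprSr.
Qed.

(** On a border at distance at least rho / 4 from c the quotient f / (z - c) ^
    m is at most M / (rho / 4) ^ m, hence |f z| <= 2 M / 2 ^ m at a point z
    with |z - c| < rho / 8, for every m. *)
Lemma flat_zero f c : Hinfty f -> md c < 1 -> flat f c ->
  forall z, md (z - c) < (1 - md c) / 8 -> f z = 0.
Proof.
move=> /HinftyP[fd [M fM]] c1 fl z; set rho := 1 - md c => zr.
have rho0 : 0 < rho by rewrite /rho; lra.
have [->|zc] := eqVneq z c.
  by have [h _ ->] := fl 1%N; rewrite subrr expr1 mul0r.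
have r0 : 0 < 3 / 8 * rho by lra.
have sq1 w : sq_around z (3 / 8 * rho) w -> md w < 1.
  move=> /sq_around_le h; have := mdD (w - z) (z - c); rewrite addrA subrK.
  by have := mdD (w - c) c; rewrite subrK /rho in zr h * => *; lra.
have M0 : 0 <= M by apply: le_trans (md_ge0 _) (fM c c1).
have bound m : md (f z) <= 2 * M / 2 ^+ m.
  have [h /HinftyP[hd [Mh hM]] fE] := fl m.
  have : md (h z) <= 2 * (M / (rho / 4) ^+ m).
    apply: (@md_center_le R h [::] z _ Mh _ r0) => //.
    - by move=> w /sq1; apply: hM.
    - by move=> w /sq1 w1 _; apply: hd.
    move=> w bw; have w1 := sq1 _ (border_sub r0 bw).
    have wc : rho / 4 <= md (w - c).
      have := border_around_ge r0 bw; have := mdD (w - c) (c - z).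
      by rewrite addrA subrK [md (c - z)]mdBC; lra.
    have p0 : 0 < (rho / 4) ^+ m by apply: exprn_gt0; lra.
    rewrite ler_pdivlMr //; apply: le_trans (fM _ w1).
    rewrite fE mdM mdX mulrC; apply: ler_wpM2r; first exact: md_ge0.
    by apply: lerXn2r => //; rewrite nnegrE; [lra | apply: md_ge0].
  move=> hz; rewrite fE mdM mdX.
  have h1 : md (z - c) ^+ m <= (rho / 8) ^+ m.
    by apply: lerXn2r; rewrite ?nnegrE ?md_ge0 //; lra.
  have p8 : 0 <= (rho / 8) ^+ m by apply: exprn_ge0; lra.
  apply: le_trans (ler_pM (exprn_ge0 _ (md_ge0 _)) (md_ge0 _) h1 hz) _.
  have -> : rho / 8 = rho / 4 / 2 by lra.
  have p4 : rho / 4 != 0 by rewrite gt_eqF //; lra.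
  have p4m : (rho / 4) ^+ m != 0 by rewrite expf_neq0.
  have p2m : 2 ^+ m != 0 :> R by rewrite expf_neq0.
  rewrite expr_div_n le_eqVlt; apply/orP; left; apply/eqP.
  move: ((rho / 4) ^+ m) (2 ^+ m) p4m p2m => a b a0 b0.
  by field; rewrite ?a0 ?b0.
apply/eqP; rewrite -md_eq0; apply/negPn/negP => fz.
have fz0 : 0 < md (f z) by rewrite lt_def fz md_ge0.
have [|k] := @halving_lt R (2 * M + 1) _ _ fz0; first lra.
have p2 : 0 < (2 ^+ k)^-1 :> R by rewrite invr_gt0 exprn_gt0.
by have := bound k; rewrite mulrDl mul1r; lra.
Qed.

Lemma near_dnbhs_zero_nonzero f c : (\forall z \near c, f z = 0) ->
  (\forall z \near c^', f z != 0) -> False.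
Proof.
move=> /near_md[d d0 dP] /near_dnbhs_md[d' d'0 d'P].
pose m := Num.min d d' / 2.
have m0 : 0 < m by rewrite /m divr_gt0 // lt_min d0.
have mm : m < Num.min d d' by rewrite /m; rewrite /m in m0; lra.
have /andP[md1 md2] : (m < d) && (m < d') by rewrite -lt_min.
have hm : md (c + (m%:C)%C - c) = m.
  by rewrite [c + _]addrC addrK md_real ger0_norm // ltW.
have := d'P (c + (m%:C)%C); rewrite dP ?hm // eqxx => h.
have : false by apply: h; rewrite // -subr_eq0 -md_eq0 hm gt_eqF.
by [].
Qed.

(** Where f vanishes near a point, it vanishes on a disk whose radius depends
    only on the distance to the unit circle; finitely many such disks join c to
    z along a segment. *)
Lemma zero_propagates f c z : Hinfty f -> md c < 1 -> md z < 1 ->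
  (\forall u \near c, f u = 0) -> \forall u \near z, f u = 0.
Proof.
move=> hf c1 z1.
have step a b : md a < 1 -> md (b - a) < (1 - md a) / 8 ->
    (\forall u \near a, f u = 0) -> \forall u \near b, f u = 0.
  move=> a1 ba fa; have [ia|fl] := isolated_or_flat hf a1.
    by case: (near_dnbhs_zero_nonzero fa ia).
  apply/near_md; exists ((1 - md a) / 8 - md (b - a)); first lra.
  move=> u ub; apply: (flat_zero hf a1 fl).
  by have := mdD (u - b) (b - a); rewrite addrA subrK; lra.
pose t := Num.max (md c) (md z).
have t1 : t < 1 by rewrite gt_max c1.
have [tc tz] : md c <= t /\ md z <= t by split; rewrite le_max lexx ?orbT.
have [N hN] : exists N : nat, md (z - c) / N.+1%:R < (1 - t) / 8.
  have t0 : 0 < (1 - t) / 8 by lra.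
  have := archi_boundP (divr_ge0 (md_ge0 (z - c)) (ltW t0)).
  set k := Num.bound _ => hk; exists k; rewrite ltr_pdivrMr ?ltr0n //.
  move: hk; rewrite ltr_pdivrMr // => hk; apply: lt_trans hk _.
  by rewrite mulrC ltr_pM2l // ltr_nat.
pose p (k : nat) := c + ((k%:R / N.+1%:R)%:C)%C * (z - c).
have p1 k : (k <= N.+1)%N -> md (p k) <= t.
  move=> kN; have k0 : 0 <= k%:R / N.+1%:R :> R by apply: divr_ge0.
  have k1 : k%:R / N.+1%:R <= 1 :> R.
    by rewrite ler_pdivrMr ?ltr0n // mul1r ler_nat.
  have -> : p k = ((1 - k%:R / N.+1%:R)%:C)%C * c + ((k%:R / N.+1%:R)%:C)%C * z.
    by rewrite /p rmorphB rmorph1; ring.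
  apply: le_trans (mdD _ _) _; rewrite !mdM !md_real !ger0_norm ?subr_ge0 //.
  move: (k%:R / N.+1%:R) k0 k1 => s s0 s1.
  have : (1 - s) * md c <= (1 - s) * t by apply: ler_wpM2l => //; lra.
  have : s * md z <= s * t by apply: ler_wpM2l.
  lra.
have pz : p N.+1 = z.
  by rewrite /p divff ?pnatr_eq0 // mul1r addrC subrK.
move=> fc; rewrite -pz; move: (leqnn N.+1); move: {1 3}N.+1 => k.
elim: k => [|k IH] kN; first by rewrite /p mul0r mul0r addr0.
have pk := p1 k (ltnW kN).
apply: (step (p k)); [lra | | exact: IH (ltnW kN)].
have -> : p k.+1 - p k = ((N.+1%:R^-1)%:C)%C * (z - c).
  rewrite /p -[k.+1]addn1 natrD mulrDl rmorphD mul1r; ring.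
by rewrite mdM md_real ger0_norm ?invr_ge0 // mulrC; apply: lt_le_trans hN _;
  lra.
Qed.

Lemma isolated_zeros f c : Hinfty f -> (exists2 z, md z < 1 & f z != 0) ->
  md c < 1 -> \forall z \near c^', f z != 0.
Proof.
move=> hf [z z1 fz] c1; have [//|fl] := isolated_or_flat hf c1.
have fc : \forall u \near c, f u = 0.
  apply/near_md; exists ((1 - md c) / 8); first lra.
  exact: flat_zero.
have /nbhs_singleton := zero_propagates hf c1 z1 fc.
by move/eqP; rewrite (negPf fz).
Qed.

End Holomorphic.

(** * The fibres of a finite Blaschke product *)

Section Blaschke.
Variables (R : realType) (n : nat) (a : 'I_n -> cplx R).
Hypothesis a_disk : forall j, md (a j) < 1.
Implicit Types (z w u v c : cplx R) (r e : R) (p : {poly cplx R}).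

Lemma derivable_poly p z : cderivable (fun u => p.[u]) z.
Proof.
elim/poly_ind: p => [|p c IH].
  apply: derivable_near (@derivable_const R 0 z).
  by apply/near_md; exists 1 => // u _; rewrite horner0.
have h : cderivable (fun u => p.[u] * (u - 0) + c) z.
  apply: (@derivable_add R (fun u => p.[u] * (u - 0)) (fun=> c)).
    exact: (@derivable_mul R _ (fun u => u - 0) z IH (derivable_subc _ _)).
  exact: derivable_const.
apply: derivable_near h; apply/near_md; exists 1 => // u _.
by rewrite !hornerE subr0.
Qed.

Lemma derivable_pow c m z : cderivable (fun u => (u - c) ^+ m) z.
Proof.
elim: m => [|m IH].
  apply: derivable_near (@derivable_const R 1 z).
  by apply/near_md; exists 1 => // u _; rewrite expr0.
apply: derivable_near (derivable_mul (@derivable_subc R z c) IH).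
by apply/near_md; exists 1 => // u _; rewrite exprS.
Qed.

Definition num : {poly cplx R} := \prod_(j < n) ((a j)%:P - 'X).

Definition den : {poly cplx R} := \prod_(j < n) (1 - ((a j)^*)%C%:P * 'X).

Lemma blaschkeE z : blaschke a z = num.[z] / den.[z].
Proof.
rewrite /blaschke prodf_div /num /den !horner_prod.
by congr (_ / _); apply: eq_bigr => j _; rewrite !hornerE.
Qed.

Lemma den_neq0 z : md z <= 1 -> den.[z] != 0.
Proof.
move=> z1; rewrite /den horner_prod; apply/prodf_neq0 => j _.
rewrite !hornerE subr_eq0; apply/eqP => h.
have := congr1 (@md R) h; rewrite md1 mdM md_conj => h1.
have : md (a j) * md z <= md (a j) * 1 by apply: ler_wpM2l => //; apply: md_ge0.
by have := a_disk j; lra.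
Qed.

Lemma md_sqr z : md z ^+ 2 = complex.Re z ^+ 2 + complex.Im z ^+ 2.
Proof.
by case: z => x y; rewrite /md /= sqr_sqrtr // addr_ge0 // sqr_ge0.
Qed.

(** The identity behind |B| < 1 inside the disk and |B| >= 1 outside. *)
Lemma factor_identity b z :
  md (1 - (b^*)%C * z) ^+ 2 - md (b - z) ^+ 2 =
    (1 - md b ^+ 2) * (1 - md z ^+ 2).
Proof. by rewrite !md_sqr; case: b z => [b1 b2] [z1 z2] /=; ring. Qed.

Lemma md_le_sqr z w : (md z <= md w) = (md z ^+ 2 <= md w ^+ 2).
Proof. by rewrite ler_pXn2r // nnegrE md_ge0. Qed.

Lemma factor_ge b z : md b < 1 -> 1 <= md z ->
  md (1 - (b^*)%C * z) <= md (b - z).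
Proof.
move=> b1 z1; rewrite md_le_sqr -subr_le0 factor_identity.
by apply: mulr_ge0_le0; rewrite ?subr_ge0 ?subr_le0 ?expr_le1 ?exprn_ege1
  ?md_ge0 // ltW.
Qed.

Lemma factor_lt b z : md b < 1 -> md z < 1 ->
  md (b - z) < md (1 - (b^*)%C * z).
Proof.
move=> b1 z1; rewrite ltNge md_le_sqr -subr_le0 factor_identity -ltNge.
by apply: mulr_gt0; rewrite subr_gt0 expr_lt1 ?md_ge0.
Qed.

Lemma md_prod (I : Type) (s : seq I) (F : I -> cplx R) :
  md (\prod_(i <- s) F i) = \prod_(i <- s) md (F i).
Proof.
by elim: s => [|i s IH]; rewrite ?big_nil ?md1 // !big_cons mdM IH.
Qed.

Lemma den_le_num z : 1 <= md z -> md den.[z] <= md num.[z].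
Proof.
move=> z1; rewrite /num /den !horner_prod !md_prod; apply: ler_prod => j _.
by rewrite md_ge0 !hornerE factor_ge.
Qed.

Lemma blaschke_disk z : (0 < n)%N -> md z < 1 -> md (blaschke a z) < 1.
Proof.
case: n a a_disk => // m b b1 _ z1; rewrite /blaschke big_ord_recl mdM md_prod.
have fle j : md ((b j - z) / (1 - (b j)^*%C * z)) < 1.
  have := factor_lt (b1 j) z1 => h.
  by rewrite mdM mdV ltr_pdivrMr ?mul1r //; apply: le_lt_trans (md_ge0 _) h.
apply: le_lt_trans (fle ord0); rewrite -[leRHS]mulr1; apply: ler_wpM2l.
  exact: md_ge0.
by apply: prodr_ile1 => j _; rewrite md_ge0 ltW.
Qed.

Lemma num_disk z : num.[z] = 0 -> md z < 1.
Proof.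
rewrite /num horner_prod => /eqP; rewrite prodf_seq_eq0 => /hasP[j _].
by rewrite !hornerE subr_eq0 => /eqP <-.
Qed.

Lemma derivable_blaschke z : md z < 1 -> cderivable (blaschke a) z.
Proof.
move=> z1.
apply: (@derivable_near R _ (fun u => num.[u] / den.[u])).
  by apply/near_md; exists 1 => // u _; apply: blaschkeE.
apply: (@derivable_div R (fun u => num.[u]) (fun u => den.[u])).
- by apply: den_neq0; apply: ltW.
- exact: derivable_poly.
- exact: derivable_poly.
Qed.

(** For |w| < 1 its roots are the solutions of B z = w, and all of them lie in
    the disk. *)
Definition level w : {poly cplx R} := num - w *: den.

Lemma coef_prod_linear m (c d : 'I_m -> cplx R) :
  (size (\prod_(j < m) ((c j)%:P + (d j)%:P * 'X))%R <= m.+1)%N /\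
  (\prod_(j < m) ((c j)%:P + (d j)%:P * 'X))`_m = \prod_(j < m) d j.
Proof.
elim: m c d => [|m IH] c d; first by rewrite !big_ord0 size_poly1 coef1.
rewrite !big_ord_recl.
have [] := IH (fun j => c (lift ord0 j)) (fun j => d (lift ord0 j)).
move: (\prod_(i < m) _) => p sp cp; split.
  apply: leq_trans (size_polyMleq _ _) _.
  have : (size ((c ord0)%:P + (d ord0)%:P * 'X)%R <= 2)%N.
    apply: leq_trans (size_polyD _ _) _; rewrite geq_max.
    rewrite (leq_trans (size_polyC_leq1 _)) // (leq_trans
      (size_polyMleq _ _)) //.
    by rewrite size_polyX addn2 /= ltnS size_polyC_leq1.
  by move/leq_add/(_ sp); case: (_ + _)%N.
rewrite mulrDl coefD coefCM -mulrA coefCM coefXM /= cp.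
by rewrite (nth_default _ sp) mulr0 add0r.
Qed.

Lemma num_linear : num = \prod_(j < n) ((a j)%:P + (-1)%:P * 'X).
Proof. by apply: eq_bigr => j _; rewrite polyCN polyC1 mulN1r. Qed.

Lemma den_linear : den = \prod_(j < n) (1%:P + (- (a j)^*%C)%:P * 'X).
Proof. by apply: eq_bigr => j _; rewrite polyCN mulNr. Qed.

Lemma size_level_le w : (size (level w) <= n.+1)%N.
Proof.
rewrite /level -scaleNr; apply: leq_trans (size_polyD _ _) _; rewrite geq_max.
rewrite {1}num_linear (coef_prod_linear _ _).1.
by apply: leq_trans (size_scale_leq _ _) _;
  rewrite den_linear (coef_prod_linear _ _).1.
Qed.

(** The coefficient of degree n is (-1) ^ n - w prod (- conj(a_j)), where the
    product has modulus at most 1. *)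
Lemma coef_level_ge w : 1 - md w <= md (level w)`_n.
Proof.
rewrite /level coefB coefZ num_linear den_linear !(coef_prod_linear _ _).2.
apply: le_trans (mdB_ge _ _); rewrite mdM !md_prod.
have -> : \prod_(j < n) md (-1) = 1 :> R.
  by rewrite (eq_bigr (fun=> 1)) ?big1 // => j _; rewrite mdN md1.
rewrite lerD2l lerN2 -[leRHS]mulr1; apply: ler_wpM2l; first exact: md_ge0.
by apply: prodr_ile1 => j _; rewrite md_ge0 mdN md_conj ltW.
Qed.

Lemma size_level w : md w < 1 -> size (level w) = n.+1.
Proof.
move=> w1; apply/eqP; rewrite eqn_leq size_level_le /= ltnNge; apply/negP => h.
by have := coef_level_ge w; rewrite (nth_default _ h) md0; lra.
Qed.

Lemma lead_level_ge w : md w < 1 -> 1 - md w <= md (lead_coef (level w)).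
Proof. by move=> w1; rewrite lead_coefE size_level //= coef_level_ge. Qed.

Lemma lead_level_neq0 w : md w < 1 -> lead_coef (level w) != 0.
Proof. by move=> w1; rewrite -md_gt0; have := lead_level_ge w1; lra. Qed.

Lemma level_horner w z : (level w).[z] = num.[z] - w * den.[z].
Proof. by rewrite /level !hornerE. Qed.

(** The solutions of B z = w with multiplicity, as the root list that splits
    the level polynomial. *)
Definition sols w : seq (cplx R) :=
  sval (@closed_field_poly_normal R[i] (level w)).

Lemma solsE w : level w =
  lead_coef (level w) *: \prod_(z <- sols w) ('X - z%:P).
Proof. exact: svalP (@closed_field_poly_normal R[i] (level w)). Qed.

Lemma size_sols w : md w < 1 -> size (sols w) = n.
Proof.
move=> w1; have := size_level w1;
  rewrite {1}solsE size_scale ?lead_level_neq0 //.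
by rewrite size_prod_XsubC => -[].
Qed.

Lemma level_horner_sols w z :
  (level w).[z] = lead_coef (level w) * \prod_(x <- sols w) (z - x).
Proof.
rewrite {1}solsE hornerZ horner_prod; congr (_ * _).
by apply: eq_bigr => x _; rewrite !hornerE.
Qed.

Lemma level_root w z : md w < 1 -> (z \in sols w) = ((level w).[z] == 0).
Proof.
move=> w1; rewrite level_horner_sols mulf_eq0 (negPf (lead_level_neq0 w1)) /=.
rewrite prodf_seq_eq0; apply/idP/hasP => [zw|[x xw]].
  by exists z => //=; rewrite subrr.
by rewrite /= subr_eq0 => /eqP ->.
Qed.

(** Outside the disk |Q| <= |P|, so P = w Q with |w| < 1 forces P = Q = 0,
    while the zeros of P lie in the disk. *)
Lemma level_root_disk w z : md w < 1 -> (level w).[z] = 0 -> md z < 1.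
Proof.
move=> w1 /eqP; rewrite level_horner subr_eq0 => /eqP h.
rewrite ltNge; apply/negP => z1; have := den_le_num z1.
rewrite h mdM => hd; have dz : md den.[z] = 0.
  have := md_ge0 den.[z]; have := md_ge0 w => w0 d0.
  have : 0 <= (1 - md w) * md den.[z] by apply: mulr_ge0 => //; lra.
  move=> ?; have : (1 - md w) * md den.[z] = 0 by lra.
  by move/eqP; rewrite mulf_eq0 => /orP[] /eqP; lra.
have : num.[z] = 0.
  by move/eqP: dz; rewrite md_eq0 => /eqP dz; rewrite h dz mulr0.
by move=> /num_disk; lra.
Qed.

Lemma level_blaschke w z : md z < 1 ->
  (level w).[z] = (blaschke a z - w) * den.[z].
Proof.
move=> z1; rewrite level_horner blaschkeE mulrBl divfK //.
by apply: den_neq0; apply: ltW.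
Qed.

Lemma mem_sols w z : md w < 1 ->
  (z \in sols w) = (md z < 1) && (blaschke a z == w).
Proof.
move=> w1; rewrite level_root //; apply/eqP/andP => [h|[z1 /eqP <-]].
  have z1 := level_root_disk w1 h; split => //.
  move: h; rewrite level_blaschke // => /eqP; rewrite mulf_eq0 subr_eq0.
  by rewrite (negPf (den_neq0 (ltW z1))) orbF.
by rewrite level_blaschke // subrr mul0r.
Qed.

Lemma prod_sub_count (s : seq (cplx R)) u w :
  \prod_(x <- s) (u - x) =
  (u - w) ^+ count_mem w s * \prod_(x <- s | x != w) (u - x).
Proof.
elim: s => [|x s IH]; first by rewrite !big_nil expr0 mul1r.
rewrite !big_cons IH /=; case: eqVneq => [->|_] /=.
  by rewrite add1n exprS mulrA.
by rewrite add0n mulrCA.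
Qed.

(** On the disk B - w is the level polynomial divided by Q, and Q has no zero
    there; splitting off the factors u - z of the root list leaves the
    cofactor. *)
Lemma order_of_root w z : (0 < n)%N -> md w < 1 -> md z < 1 ->
  zero_of_order (fun u => blaschke a u - w) z (count_mem z (sols w)).
Proof.
move=> n0 w1 z1.
pose k : {poly cplx R} :=
  lead_coef (level w) *: \prod_(x <- sols w | x != z) ('X - x%:P).
have kE u : k.[u] = lead_coef (level w) * \prod_(x <- sols w | x != z) (u - x).
  rewrite hornerZ horner_prod; congr (_ * _).
  by apply: eq_bigr => x _; rewrite !hornerE.
exists (fun u => k.[u] / den.[u]); split.
- move=> u /unit_diskE u1; apply/cderivableP.
  apply: (@derivable_div R (fun u => k.[u]) (fun u => den.[u])).
  + by apply: den_neq0; apply: ltW.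
  + exact: derivable_poly.
  + exact: derivable_poly.
- apply: mulf_neq0; last by rewrite invr_eq0 den_neq0 // ltW.
  rewrite kE mulf_neq0 ?lead_level_neq0 // prodf_seq_neq0; apply/allP => x _.
  by apply/implyP => xz; rewrite subr_eq0 eq_sym.
move=> u /unit_diskE u1; have du := den_neq0 (ltW u1).
apply: (mulIf du); rewrite -level_blaschke // mulrA divfK //.
by rewrite level_horner_sols (prod_sub_count _ _ z) kE mulrCA.
Qed.

(** Dividing two expressions of F by (u - w) ^ m shows that a larger order m'
    would make the cofactor h vanish at w. *)
Lemma zero_of_order_le (F : cplx R -> cplx R) w (m m' : nat) : md w < 1 ->
  zero_of_order F w m -> zero_of_order F w m' -> (m' <= m)%N.
Proof.
move=> w1 [h [hd hw hE]] [h' [hd' hw' hE']]; rewrite leqNgt; apply/negP => mm.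
pose k u := h u - (u - w) ^+ (m' - m) * h' u.
have kw : k w != 0.
  by rewrite /k subrr expr0n subn_eq0 leqNgt mm mul0r subr0.
have kc : ccont k w.
  have dh : cderivable h w by apply/cderivableP/hd/unit_diskE.
  have dh' : cderivable h' w by apply/cderivableP/hd'/unit_diskE.
  exact: derivable_continuous (derivable_sub dh (derivable_mul
    (derivable_pow _ _ _) dh')).
have /near_md[d d0 dP] := continuous_neq0 kc kw.
pose t := Num.min d (1 - md w) / 2.
have mm0 : 0 < Num.min d (1 - md w) by rewrite lt_min d0; lra.
have t0 : 0 < t by rewrite /t; lra.
have /andP[td tw] : (t < d) && (t < 1 - md w) by rewrite -lt_min /t; lra.
pose u := w + (t%:C)%C.
have uw : md (u - w) = t by rewrite /u addrC addKr md_real gtr0_norm.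
have u1 : md u < 1.
  by have := mdD (u - w) w; rewrite subrK uw; lra.
have uw0 : (u - w) ^+ m != 0 by rewrite expf_neq0 // -md_eq0 uw gt_eqF.
have ku : k u != 0 by apply: dP; rewrite uw.
have /unit_diskE ud := u1.
move/eqP: ku; apply; apply: (mulfI uw0).
by rewrite /k mulr0 mulrBr mulrA -exprD subnKC ?(ltnW mm) // -hE // -hE' //
  subrr.
Qed.

(** Both lists satisfy is_fiber, and orders of zeros are unique, so all
    multiplicities agree. *)
Lemma fiber_sols z : (0 < n)%N -> md z < 1 ->
  perm_eq (fiber (blaschke a) z) (sols (blaschke a z)).
Proof.
move=> n0 z1; have w1 := blaschke_disk n0 z1; set w := blaschke a z in w1 *.
have fibr : is_fiber (blaschke a) z (sols w).
  split=> [x|x /unit_diskE x1].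
    by rewrite mem_sols // => /andP[x1 _]; apply/unit_diskE.
  exact: order_of_root.
have : is_fiber (blaschke a) z (fiber (blaschke a) z).
  have := @xgetI _ [::] [set s | is_fiber (blaschke a) z s] (sols w) fibr.
  exact.
move: (fiber _ _) => s [sd sc].
have [rd rc] := fibr.
apply/allP => x _ /=; have [x1|x1] := boolP (md x < 1).
  have /unit_diskE xd := x1.
  rewrite eqn_leq; apply/andP; split.
    exact: zero_of_order_le x1 (rc _ xd) (sc _ xd).
  exact: zero_of_order_le x1 (sc _ xd) (rc _ xd).
rewrite (count_memPn _) ?(count_memPn _) //.
  by apply/negP => /rd/unit_diskE; apply/negP.
by apply/negP => /sd/unit_diskE; apply/negP.
Qed.

End Blaschke.

(** * Critical values and local branches of the fibre *)

Section Branches.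
Variables (R : realType) (n : nat) (a : 'I_n -> cplx R).
Hypothesis a_disk : forall j, md (a j) < 1.
Hypothesis n_gt0 : (0 < n)%N.
Implicit Types (z w u v c : cplx R) (r e : R) (p : {poly cplx R}).

Local Notation B := (blaschke a).
Local Notation num := (num a).
Local Notation den := (den a).
Local Notation level := (level a).
Local Notation sols := (sols a).

(** The numerator of the derivative of B. *)
Definition wronskian : {poly cplx R} := num^`() * den - num * den^`().

Lemma coprime_num_den : coprimep num den.
Proof.
apply/(@Pdiv.ClosedField.coprimepP R[i] num den) => x /eqP h.
by apply: den_neq0 => //; apply: ltW; apply: num_disk h.
Qed.

Lemma deriv_num_neq0 : num^`() != 0.
Proof.
apply/negP => /eqP h.
have : (num^`())`_n.-1 = 0 by rewrite h coef0.
rewrite coef_deriv prednK // => /eqP; rewrite mulrn_eq0 eqn0Ngt n_gt0 /=.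
rewrite num_linear (coef_prod_linear _ _).2 prodf_seq_eq0 => /hasP[j _] /=.
by rewrite oppr_eq0 oner_eq0.
Qed.

(** If P' Q = P Q', then P divides P', since P and Q are coprime; this is
    excluded by degrees. *)
Lemma wronskian_neq0 : wronskian != 0.
Proof.
rewrite /wronskian subr_eq0; apply/negP => /eqP h.
have : num %| num^`() * den by rewrite h dvdp_mulr.
rewrite (Gauss_dvdpl _ coprime_num_den) => /(dvdp_leq deriv_num_neq0).
rewrite leqNgt lt_size_deriv //; apply/eqP => num0.
by have := deriv_num_neq0; rewrite num0 deriv0 eqxx.
Qed.

(** A repeated root z of P - w Q satisfies P = w Q and P' = w Q'. *)
Lemma critical_value w : md w < 1 -> ~~ uniq (sols w) ->
  exists2 z, root wronskian z & w = B z.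
Proof.
move=> w1 nu.
have [z [zin zin2]] : exists z, z \in sols w /\ z \in rem z (sols w).
  elim: (sols w) nu => [//|x s IH] /=.
  rewrite negb_and negbK; case/orP => [xs|/IH[z [zs zr]]].
    by exists x; rewrite mem_head eqxx.
  exists z; split; first by rewrite inE zs orbT.
  by case: (x == z) => //; rewrite inE zr orbT.
have := zin; rewrite (mem_sols a_disk) // => /andP[z1 /eqP zw]; exists z => //.
pose k : {poly cplx R} :=
  lead_coef (level w) *: \prod_(x <- rem z (rem z (sols w))) ('X - x%:P).
have fE : level w = ('X - z%:P) * (('X - z%:P) * k).
  rewrite solsE (big_rem z) //= (big_rem z) //= /k.
  by rewrite -!scalerAr.
have f0 : (level w).[z] = 0 by rewrite fE hornerM hornerXsubC subrr mul0r.
have f1 : (level w)^`().[z] = 0.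
  rewrite fE derivM hornerD !hornerM hornerXsubC subrr !mul0r mulr0 addr0 //.
move: f0 f1; rewrite level_horner derivB derivZ hornerD hornerN hornerZ.
move=> /eqP; rewrite subr_eq0 => /eqP h0 /eqP; rewrite subr_eq0 => /eqP h1.
by apply/eqP; rewrite /wronskian !hornerE h0 h1; ring.
Qed.

Lemma roots_seq p : p != 0 -> exists s : seq (cplx R), forall z, root p z ->
  z \in s.
Proof.
move=> p0; have [s sE] := @closed_field_poly_normal R[i] p; exists s => z.
rewrite sE rootZ ?lead_coef_eq0 // root_prod_XsubC; exact.
Qed.

Lemma critical_values : exists2 s : seq (cplx R),
  (forall w, w \in s -> md w < 1) &
  (forall w, md w < 1 -> w \notin s -> uniq (sols w)).
Proof.
have [s sP] := roots_seq wronskian_neq0.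
exists [seq w <- map B s | md w < 1].
  by move=> w; rewrite mem_filter => /andP[].
move=> w w1; apply: contraR => nu; rewrite mem_filter w1 /=.
by have [z /sP zs ->] := critical_value w1 nu; apply: map_f.
Qed.

(** A polynomial whose zeros in the disk are the points of the fibres over
    s. *)
Definition over_poly (s : seq (cplx R)) :
  {poly cplx R} := \prod_(w <- s) level w.

Lemma over_poly_neq0 s : (forall w, w \in s -> md w < 1) -> over_poly s != 0.
Proof.
move=> s1; rewrite /over_poly prodf_seq_neq0; apply/allP => w ws /=.
by rewrite -lead_coef_eq0 lead_level_neq0 // s1.
Qed.

Lemma over_poly_root s z : md z < 1 -> ((over_poly s).[z] == 0) = (B z \in s).
Proof.
move=> z1; rewrite /over_poly horner_prod prodf_seq_eq0.
have dz := den_neq0 a_disk (ltW z1).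
apply/hasP/idP => [[w ws /=]|zs].
  by rewrite level_blaschke // mulf_eq0 (negPf dz) orbF subr_eq0 => /eqP ->.
by exists (B z) => //=; rewrite level_blaschke // subrr mul0r.
Qed.

Lemma near_poly_neq0 p c : p != 0 -> \forall z \near c^', p.[z] != 0.
Proof.
move=> p0; have [s sP] := roots_seq p0.
suff : \forall z \near c^', z \notin s.
  by apply: filterS => z; apply: contra => /sP.
elim: s {sP} => [|x s IH].
  by apply/near_dnbhs_md; exists 1 => // u.
have hx : \forall z \near c^', z != x.
  have [<-|xc] := eqVneq c x; first by apply/near_dnbhs_md; exists 1.
  apply/near_dnbhs_md; exists (md (x - c)); first
    by rewrite md_gt0 subr_eq0 eq_sym.
  by move=> u uc; apply: contraTneq => ->; rewrite ltxx.
by apply: filterS2 IH hx => z zs zx; rewrite inE negb_or zs zx.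
Qed.

(** At a simple root c the level polynomial is (X - c) k with k.[c] != 0, and
    beta = k / Q is the slope of B at c. *)
Lemma slope_blaschke w c : md w < 1 -> uniq (sols w) -> c \in sols w ->
  exists beta : cplx R -> cplx R, [/\ cderivable beta c, beta c != 0 &
    forall u, md u < 1 -> B u = w + beta u * (u - c)].
Proof.
move=> w1 uw cw.
pose k : {poly cplx R} :=
  lead_coef (level w) *: \prod_(x <- rem c (sols w)) ('X - x%:P).
have fE : level w = ('X - c%:P) * k.
  by rewrite solsE (big_rem c) //= /k -scalerAr.
have c1 : md c < 1 by move: cw; rewrite (mem_sols a_disk) // => /andP[].
have dc := den_neq0 a_disk (ltW c1).
exists (fun u => k.[u] / den.[u]); split.
- exact: derivable_div dc (derivable_poly _ _) (derivable_poly _ _).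
- rewrite mulf_neq0 ?invr_eq0 // /k hornerZ mulf_neq0 ?lead_level_neq0 //.
  by rewrite -rootE root_prod_XsubC mem_rem_uniq // !inE eqxx.
move=> u u1; have du := den_neq0 a_disk (ltW u1).
have h : (B u - w) * den.[u] = (u - c) * k.[u].
  by rewrite -level_blaschke // fE hornerM hornerXsubC.
by apply: (mulIf du); rewrite mulrDl mulrAC divfK // [_ * (u - c)]mulrC -h;
  ring.
Qed.

Lemma derive1_blaschke_neq0 z : md z < 1 -> uniq (sols (B z)) ->
  derive1 B z != 0.
Proof.
move=> z1 uz; have w1 := blaschke_disk a_disk n_gt0 z1.
have zz : z \in sols (B z) by rewrite (mem_sols a_disk) // z1 eqxx.
have [beta [bd b0 bE]] := slope_blaschke w1 uz zz.
rewrite (@slope_derive R B beta z (derivable_continuous bd) _).2 //.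
apply/near_md; exists (1 - md z); first lra.
by move=> u uz'; apply: bE; have := mdD (u - z) z; rewrite subrK; lra.
Qed.

Lemma nearest (s : seq (cplx R)) c : s != [::] ->
  exists2 x, x \in s & forall y, y \in s -> md (c - x) <= md (c - y).
Proof.
elim: s => [//|x s IH] _; have [->|/IH[y ys yP]] := eqVneq s [::].
  by exists x; [rewrite mem_head | move=> y; rewrite inE => /eqP ->].
have [h|h] := leP (md (c - x)) (md (c - y)).
  exists x; first exact: mem_head.
  by move=> t; rewrite inE => /orP[/eqP->//|/yP]; apply: le_trans.
exists y; first by rewrite inE ys orbT.
by move=> t; rewrite inE => /orP[/eqP->|/yP//]; apply: ltW.
Qed.

(** |P - w Q| at c is the leading coefficient times the product of the n
    distances from c to the roots, hence at least that times the n-th power of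
    the smallest distance. *)
Lemma close_root w c : md w < 1 -> exists2 x, x \in sols w &
  md (c - x) ^+ n <= md (level w).[c] / md (lead_coef (level w)).
Proof.
move=> w1; have sn := size_sols a_disk w1.
have [|x xs xP] := @nearest (sols w) c.
  by rewrite -size_eq0 sn -lt0n.
exists x => //; rewrite ler_pdivlMr; last by rewrite md_gt0 lead_level_neq0.
rewrite level_horner_sols mdM mulrC; apply: ler_wpM2l; first exact: md_ge0.
rewrite md_prod; suff : md (c - x) ^+ size (sols w) <=
  \prod_(y <- sols w) md (c - y).
  by rewrite sn.
move: xP {xs sn}.
elim: (sols w) => [|y s IH] h; first by rewrite big_nil.
rewrite big_cons /= exprS; apply: ler_pM; rewrite ?exprn_ge0 ?md_ge0 //.
  by apply: h; rewrite mem_head.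
by apply: IH => t ts; apply: h; rewrite inE ts orbT.
Qed.

(** Let r i w be a root of P - w Q close to the i-th root for w0, as provided
    by [close_root]; it tends to that root as w tends to w0. The slopes of B at
    the simple roots turn this continuity into differentiability. For w near w0
    the r i w are distinct, so they exhaust the n roots. *)
Lemma branches w0 : md w0 < 1 -> uniq (sols w0) ->
  exists r : 'I_n -> cplx R -> cplx R,
  [/\ forall i, cderivable (r i) w0, forall i, r i w0 = (sols w0)`_i &
      \forall w \near w0, md w < 1 /\ perm_eq
        (sols w) [seq r i w | i <- enum 'I_n]].
Proof.
move=> w1 uw; have sn := size_sols a_disk w1.
pose P (q : 'I_n * cplx R) x := md q.2 < 1 -> x \in sols q.2 /\
  md ((sols w0)`_q.1 - x) ^+ n <=
    md (level q.2).[(sols w0)`_q.1] / md (lead_coef (level q.2)).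
have exP q : exists x, P q x.
  case: q => i w; rewrite /P /=.
  have [w1'|w1'] := boolP (md w < 1); last by exists 0.
  by have [x xw xP] := close_root (sols w0)`_i w1'; exists x.
have [r rP] := choice exP.
have r0 i : r (i, w0) = (sols w0)`_i.
  have [_] := rP (i, w0) w1 => /=.
  have /eqP -> : (level w0).[(sols w0)`_i] == 0.
    by rewrite -level_root // mem_nth // sn.
  rewrite md0 mul0r => h; apply/eqP; rewrite eq_sym -subr_eq0 -md_eq0.
  by have := le_anti (introT andP (conj h (exprn_ge0 n (md_ge0 _)))) => /eqP;
    rewrite expf_eq0 => /andP[_ ->].
have rc i : ccont (fun w => r (i, w)) w0.
  set c := (sols w0)`_i.
  apply/continuous_md => e e0; rewrite r0 -/c.
  pose q := md den.[c] + 1; have q0 : 0 < q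
    by have := md_ge0 den.[c]; rewrite /q; lra.
  pose h := (1 - md w0) / 2; have h0 : 0 < h by rewrite /h; lra.
  have en0 : 0 < e ^+ n by apply: exprn_gt0.
  exists (Num.min h (e ^+ n * h / q)).
    by rewrite lt_min h0 divr_gt0 // mulr_gt0.
  move=> w; rewrite lt_min => /andP[wh wq].
  have w1' : md w < 1 - h.
    by have := mdD (w - w0) w0; rewrite subrK /h in wh *; lra.
  have [|_ /= hr] := rP (i, w); first by rewrite /=; lra.
  have lc : h <= md (lead_coef (level w)).
    by apply: le_trans (lead_level_ge a_disk _); lra.
  have fc : md (level w).[c] <= md (w - w0) * q.
    have : (level w0).[c] == 0 by rewrite -level_root // mem_nth // sn.
    rewrite !level_horner subr_eq0 => /eqP ->; rewrite -mulrBl mdM mdBC.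
    by apply: ler_wpM2l; [exact: md_ge0 | rewrite /q; lra].
  have : md (r (i, w) - c) ^+ n < e ^+ n.
    rewrite mdBC; apply: le_lt_trans hr _; rewrite -/c ltr_pdivrMr; last lra.
    apply: le_lt_trans fc _; apply: lt_le_trans (_ : e ^+ n * h <= _).
      by move: wq; rewrite ltr_pdivlMr.
    by apply: ler_wpM2l => //; apply: ltW.
  by rewrite ltr_pXn2r // ?nnegrE ?md_ge0 // ltW.
have inD : \forall w \near w0, md w < 1.
  apply/near_md; exists (1 - md w0); first lra.
  by move=> u uw'; have := mdD (u - w0) w0; rewrite subrK; lra.
exists (fun i w => r (i, w)); split => //.
- move=> i; have cw : (sols w0)`_i \in sols w0 by rewrite mem_nth // sn.
  have [beta [bd b0 bE]] := slope_blaschke w1 uw cw.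
  have bi : ccont (fun u => (beta u)^-1) (r (i, w0)).
    by rewrite r0; apply: derivable_continuous; apply: derivable_inv.
  have br : ccont (fun w => beta (r (i, w))) w0.
    by apply: continuous_compose (rc i) _; rewrite r0;
      apply: derivable_continuous.
  have br0 : beta (r (i, w0)) != 0 by rewrite r0.
  apply: (@slope_derive R _ _ w0 (continuous_compose (rc i) bi) _).1.
  have bn := continuous_neq0 br br0.
  apply: filterS2 inD bn => w wd bw.
  have [/= rw _] := rP (i, w) wd.
  move: rw; rewrite (mem_sols a_disk) // => /andP[rd /eqP wE].
  have h : w - w0 = beta (r (i, w)) * (r (i, w) - (sols w0)`_i).
    by apply/eqP; rewrite subr_eq addrC -{1}wE (bE _ rd).
  by rewrite h r0 mulKf // addrC subrK.
have sep : \forall w \near w0, forall i, forall j : 'I_n,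
    i != j -> r (i, w) != r (j, w).
  apply: (@filter_forall (cplx R) 'I_n
    (fun i w => forall j : 'I_n, i != j ->
      r (i, w) != r (j, w)) (nbhs w0)) => i.
  apply: (@filter_forall (cplx R) 'I_n
    (fun j w => i != j -> r (i, w) != r (j, w)) (nbhs w0)) => j.
  have [<-|ij] := eqVneq i j; first by apply: filterS inD => w _; rewrite eqxx.
  have kc : ccont (fun w => r (i, w) - r (j, w)) w0.
    exact: (@continuousB (cplx R) (cplx R) (cplx R) _ _ w0 (rc i) (rc j)).
  have k0 : r (i, w0) - r (j, w0) != 0.
    by rewrite !r0 subr_eq0 nth_uniq ?sn.
  by apply: filterS (continuous_neq0 kc k0) => w; rewrite subr_eq0.
apply: filterS2 inD sep => w wd sw; split => //.
have um : uniq [seq r (i, w) | i <- enum 'I_n].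
  rewrite map_inj_uniq ?enum_uniq // => i j /eqP.
  by apply: contraTeq => /sw.
have sub : {subset [seq r (i, w) | i <- enum 'I_n] <= sols w}.
  by move=> _ /mapP[i _ ->]; have [] := rP (i, w) wd.
have ssz : (size (sols w) <= size [seq r (i, w) | i <- enum 'I_n])%N.
  by rewrite size_map size_enum_ord size_sols.
have [e1 e2] := uniq_min_size um sub ssz.
rewrite perm_sym; apply: uniq_perm => //.
exact: leq_size_uniq sub ssz.
Qed.

End Branches.

(** * Counting the coincidences of g on a fibre *)

Section Coefficients.
Variable R : realType.
Implicit Types (z c : cplx R) (s : seq (cplx R)).

Lemma coef_addX_mul c (p : {poly cplx R}) j :
  (('X + c%:P) * p)`_j = (if j is j'.+1 then p`_j' else 0) + c * p`_j.
Proof. by rewrite mulrDl coefD coefXM coefCM; case: j. Qed.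

(** The product is X ^ m times the product of the factors with c != 0, where m
    is the number of c equal to 0. *)
Lemma prod_addX_order s : let p := \prod_(c <- s) ('X + c%:P) in
  (forall j, (j < count_mem 0%R s)%N -> p`_j = 0) /\ p`_(count_mem 0 s) != 0.
Proof.
elim: s => [|c s [IH1 IH2]] /=; first by rewrite big_nil coef1 oner_eq0; split.
rewrite big_cons; move: (\prod_(x <- s) _) IH1 IH2 => p IH1 IH2.
case: eqVneq => [->|c0] /=; rewrite ?add1n ?add0n.
  split=> [[|j] jc|]; rewrite coef_addX_mul mul0r ?add0r ?addr0 //.
  exact: IH1.
split=> [j jc|].
  rewrite coef_addX_mul (IH1 _ jc) mulr0 addr0.
  by case: j jc => // j jc; apply: IH1; apply: ltnW.
rewrite coef_addX_mul; move: IH1 IH2; case: (count_mem 0 s) => [|m] IH1 IH2.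
  by rewrite add0r mulf_neq0.
by rewrite IH1 // add0r mulf_neq0.
Qed.

Lemma prod_addX_bound s (K : R) j : (forall c, c \in s -> md c <= K) ->
  md (\prod_(c <- s) ('X + c%:P))`_j <= (1 + K) ^+ size s.
Proof.
elim: s j => [|c s IH] j cK.
  by rewrite big_nil coef1 expr0; case: (j == 0)%N; rewrite ?md1 ?md0.
have K0 : 0 <= K by apply: le_trans (md_ge0 c) (cK _ _); rewrite mem_head.
have {}IH i : md (\prod_(c <- s) ('X + c%:P))`_i <= (1 + K) ^+ size s.
  by apply: IH => x xs; apply: cK; rewrite inE xs orbT.
have e0 : 0 <= (1 + K) ^+ size s by apply: exprn_ge0; lra.
rewrite big_cons coef_addX_mul /= exprS mulrDl mul1r.
apply: le_trans (mdD _ _) _; apply: lerD.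
  by case: j => [|j]; rewrite ?md0.
by rewrite mdM; apply: ler_pM; rewrite ?md_ge0 //; apply: cK; rewrite mem_head.
Qed.

Lemma derivable_coef_prod (I : Type) (s : seq I) (c : I -> cplx R ->
  cplx R) z j :
  (forall i, cderivable (c i) z) ->
  cderivable (fun u => (\prod_(i <- s) ('X + (c i u)%:P))`_j) z.
Proof.
move=> dc; elim: s j => [|i s IH] j.
  apply: derivable_near (@derivable_const R (1 : {poly cplx R})`_j z).
  by apply/near_md; exists 1 => // u _; rewrite big_nil.
pose p u := \prod_(i <- s) ('X + (c i u)%:P).
have h : cderivable (fun u =>
  (if j is j'.+1 then (p u)`_j' else 0) + c i u * (p u)`_j) z.
  apply: derivable_add (derivable_mul (dc i) (IH j)).
  by case: j => [|j]; [exact: derivable_const | exact: IH].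
by apply: derivable_near h; apply/near_md; exists 1 => // u _;
  rewrite big_cons coef_addX_mul.
Qed.

(** A list in which every value occurs k times is cut into blocks of size k. *)
Lemma dvdn_size_count (T : eqType) (k : nat) (s : seq T) :
  (forall v, v \in s -> count_mem v s = k) -> (k %| size s)%N.
Proof.
move: {2}(size s) (leqnn (size s)) => m.
elim: m s => [|m IH] s; first by rewrite leqn0 size_eq0 => /eqP ->.
case: s => [//|v s] sm hs; set t := v :: s.
have -> : size t = (count_mem v t + size [seq y <- t | y != v])%N.
  by rewrite size_filter -(count_predC (pred1 v) t).
rewrite hs ?mem_head // dvdn_addr //; apply: IH.
  rewrite /= eqxx /= size_filter -ltnS; apply: leq_trans sm; exact: count_size.
move=> u; rewrite mem_filter => /andP[uv ut].
rewrite count_filter -(hs u ut); apply: eq_count => y /=.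
by case: eqVneq => // ->; exact: uv.
Qed.

Lemma poly_bounded (p : {poly cplx R}) :
  exists K : R, forall z, md z <= 1 -> md p.[z] <= K.
Proof.
elim/poly_ind: p => [|p c [K KP]]; first
  by exists 0 => z _; rewrite horner0 md0.
exists (K + md c) => z z1; rewrite hornerMXaddC.
apply: le_trans (mdD _ _) _; rewrite lerD2r mdM.
have := KP z z1; have := md_ge0 p.[z] => p0 pK.
apply: le_trans pK; rewrite -[leRHS]mulr1; exact: ler_wpM2l.
Qed.

Lemma ccont_eq (f g : cplx R -> cplx R) z : ccont f z -> ccont g z ->
  (\forall u \near z^', f u = g u) -> f z = g z.
Proof.
move=> fc gc fg; apply/eqP; rewrite -subr_eq0; apply/negPn/negP => ne.
have kc : ccont (fun u => f u - g u) z.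
  exact: (@continuousB (cplx R) (cplx R) (cplx R) _ _ z fc gc).
have /near_md[d d0 dP] := continuous_neq0 kc ne.
have h : \forall u \near z^', f u - g u != 0.
  by apply/near_dnbhs_md; exists d => // u _; apply: dP.
have [u [fu gu]] := filter_ex (filterI fg h).
by move: gu; rewrite fu subrr eqxx.
Qed.

End Coefficients.

Section Main.
Variables (R : realType) (n : nat) (a : 'I_n -> cplx R) (g : cplx R -> cplx R).
Hypothesis a_disk : forall j, md (a j) < 1.
Hypothesis n_prime : prime n.
Hypothesis g_Hinfty : Hinfty g.
Implicit Types (z w u v c x : cplx R) (r e : R).

Local Notation B := (blaschke a).
Local Notation sols := (sols a).

(** What the vanishing of Gamma g gives on a regular fibre. *)
Hypothesis collision : forall z, md z < 1 -> uniq (sols (B z)) ->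
  exists2 x, x \in sols (B z) & x != z /\ g x = g z.

Let n_gt0 : (0 < n)%N := prime_gt0 n_prime.

(** A finite set of values off which the fibres have n distinct points. *)
Variable crit : seq (cplx R).
Hypothesis crit_disk : forall w, w \in crit -> md w < 1.
Hypothesis regular : forall w, md w < 1 -> w \notin crit -> uniq (sols w).

Let delta : {poly cplx R} := over_poly a crit.

Let B_disk z : md z < 1 -> md (B z) < 1.
Proof. exact: blaschke_disk. Qed.

Let self_mem z : md z < 1 -> z \in sols (B z).
Proof. by move=> z1; rewrite (mem_sols a_disk) ?B_disk // z1 eqxx. Qed.

Let sols_disk w x : md w < 1 -> x \in sols w -> md x < 1.
Proof. by move=> w1; rewrite (mem_sols a_disk) // => /andP[]. Qed.

Let sols_val w x : md w < 1 -> x \in sols w -> B x = w.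
Proof. by move=> w1; rewrite (mem_sols a_disk) // => /andP[_ /eqP]. Qed.

Definition gap z : {poly cplx R} :=
  \prod_(x <- sols (B z)) ('X + (g z - g x)%:P).

(** The number of points of the fibre through z at which g takes the value g
    z. *)
Definition mult z := count (fun x => g x == g z) (sols (B z)).

Lemma gap_order z : (forall j, (j < mult z)%N -> (gap z)`_j = 0) /\
  (gap z)`_(mult z) != 0.
Proof.
have := prod_addX_order [seq g z - g x | x <- sols (B z)].
rewrite big_map count_map /= (@eq_count _ _ (fun x => g x == g z)) //.
by move=> x /=; rewrite subr_eq0 eq_sym.
Qed.

Lemma gap_bounded j : exists K : R, forall z, md z < 1 -> md (gap z)`_j <= K.
Proof.
have [_ [M gM]] := (HinftyP g).1 g_Hinfty.
exists ((1 + (M + M)) ^+ n) => z z1.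
have := @prod_addX_bound R [seq g z - g x | x <- sols (B z)] (M + M) j.
rewrite big_map size_map (size_sols a_disk) ?B_disk //; apply.
move=> _ /mapP[x xr ->]; apply: le_trans (mdD _ _) _; rewrite mdN.
by apply: lerD; apply: gM => //; apply: sols_disk xr; apply: B_disk.
Qed.

(** A coefficient of gap is symmetric in the fibre, so it may be computed on
    the branches, which are differentiable at a regular value. *)
Lemma gap_derivable z j : md z < 1 -> B z \notin crit ->
  cderivable (fun u => (gap u)`_j) z.
Proof.
move=> z1 zc; have w1 := B_disk z1; have uw := regular w1 zc.
have [gd _] := (HinftyP g).1 g_Hinfty.
have dB := derivable_blaschke a_disk z1.
have [r [rd r0 /near_md[d d0 dP]]] := branches a_disk n_gt0 w1 uw.
have h : cderivable (fun u => (\prod_(i <- enum 'I_n)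
    ('X + (g u - g (r i (B u)))%:P))`_j) z.
  apply: (@derivable_coef_prod R _ _ (fun i u => g u - g (r i (B u)))) => i.
    apply: derivable_sub (gd _ z1) _.
  apply: (@derivable_comp1 R (fun u => r i (B u)) g).
    exact: (@derivable_comp1 R B (r i) z dB (rd i)).
  by apply: gd; rewrite r0; apply: (sols_disk w1);
    rewrite mem_nth // (size_sols a_disk).
apply: derivable_near h.
have [d' d'0 d'P] := (continuous_md B z).1 (derivable_continuous dB) _ d0.
apply/near_md; exists d' => // u /d'P /dP[_ pe].
by rewrite /gap (perm_big _ pe) big_map.
Qed.

(** The coefficients of gap are not known to be holomorphic on the critical
    fibres; multiplying by a square that vanishes there makes them so. *)
Definition gapD j z := (gap z)`_j * delta.[z] ^+ 2.

Lemma delta_neq0 : delta != 0.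
Proof. exact: over_poly_neq0. Qed.

Lemma delta_root z : md z < 1 -> (delta.[z] == 0) = (B z \in crit).
Proof. exact: over_poly_root. Qed.

Lemma gapD_Hinfty j : Hinfty (gapD j).
Proof.
have [K KP] := gap_bounded j.
have K0 : 0 <= K by apply: le_trans (md_ge0 _) (KP 0 _); rewrite md0.
have [Q QP] := poly_bounded (delta ^+ 2).
apply/HinftyP; split; last first.
  exists (K * Q) => z z1; rewrite /gapD mdM -horner_exp.
  by apply: ler_pM; rewrite ?md_ge0 //; [apply: KP | apply/QP/ltW].
move=> z z1; have [dz|dz] := eqVneq delta.[z] 0; last first.
  apply: (@derivable_mul R (fun u => (gap u)`_j) (fun u => delta.[u] ^+ 2)).
    by apply: gap_derivable; rewrite -?delta_root.
  apply: derivable_near (derivable_poly (delta ^+ 2) z).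
  by apply/near_md; exists 1 => // u _; rewrite horner_exp.
have /factor_theorem[k kE] : root delta z by apply/rootP.
(* At a zero z of delta = k (X - z) the slope is gap_j k ^ 2 (X - z), which
   tends to 0 because gap_j is bounded. *)
pose k2 := k ^+ 2 * ('X - z%:P).
have k2z : k2.[z] = 0 by rewrite hornerM hornerXsubC subrr mulr0.
apply: (@slope_derive R _ (fun u => (gap u)`_j * k2.[u]) z _ _).1; last first.
  apply/near_md; exists 1 => // u _; rewrite /gapD dz expr0n mulr0 add0r.
  by rewrite kE /k2 !hornerM ?horner_exp hornerXsubC; ring.
apply/continuous_md => e e0.
have ek : 0 < e / (K + 1) by apply: divr_gt0; lra.
have [d d0 dP] := (continuous_md _ z).1 (derivable_continuous
  (derivable_poly k2 z)) _ ek.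
exists (Num.min d (1 - md z)); first by rewrite lt_min d0; lra.
move=> u; rewrite lt_min => /andP[/dP ud uz]; rewrite k2z mulr0 subr0 mdM.
rewrite k2z subr0 ltr_pdivlMr in ud; last lra.
have u1 : md u < 1 by have := mdD (u - z) z; rewrite subrK; lra.
have : md (gap u)`_j * md k2.[u] <= K * md k2.[u].
  by apply: ler_wpM2r; [exact: md_ge0 | exact: KP].
by have := md_ge0 k2.[u]; lra.
Qed.

Definition nonzero_at j :=
  exists z, [/\ md z < 1, B z \notin crit & (gap z)`_j != 0].

Lemma regular_near z : md z < 1 ->
  \forall u \near z^', md u < 1 /\ B u \notin crit.
Proof.
move=> z1; have /near_dnbhs_md[d d0 dP] := near_poly_neq0 z delta_neq0.
apply/near_dnbhs_md; exists (Num.min d (1 - md z)); first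
  by rewrite lt_min d0; lra.
move=> u uz; rewrite lt_min => /andP[ud uz'].
have u1 : md u < 1 by have := mdD (u - z) z; rewrite subrK; lra.
by split=> //; rewrite -delta_root // dP.
Qed.

Lemma exists_regular : exists2 z, md z < 1 & B z \notin crit.
Proof.
have h0 : md 0 < 1 :> R by rewrite md0.
by have [z [z1 zc]] := filter_ex (regular_near h0); exists z.
Qed.

(** With k the least index of a coefficient that is not identically zero, all
    coefficients below k vanish at every regular z, which bounds mult z
    below. *)
Lemma generic_order : exists k, [/\ nonzero_at k &
  forall z, md z < 1 -> B z \notin crit -> (k <= mult z)%N].
Proof.
have ex : exists j, `[< nonzero_at j >].
  have [z z1 zc] := exists_regular; exists (mult z); apply/asboolP.
  by exists z; split=> //; apply: (gap_order z).2.
case: (ex_minnP ex) => k /asboolP kn kmin; exists k; split=> // z z1 zc.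
apply: kmin; apply/asboolP; exists z; split=> //; apply: (gap_order z).2.
Qed.

Lemma mult_ge2 z : md z < 1 -> B z \notin crit -> (1 < mult z)%N.
Proof.
move=> z1 zc; have uz := regular (B_disk z1) zc.
have [x xr [xz gx]] := collision z1 uz.
have zr := self_mem z1.
rewrite /mult (permP (perm_to_rem zr)) /= eqxx add1n ltnS -has_count.
apply/hasP; exists x; last by rewrite /= gx eqxx.
by rewrite mem_rem_uniq // !inE xz xr.
Qed.

(** The zeros of the k-th coefficient are isolated, so for w close to a regular
    value w0 but different from it, all the points of the fibre over w, each
    close to and different from a point of the fibre over w0, avoid them. *)
Lemma generic_fibre k : nonzero_at k -> exists w, [/\ md w < 1, w \notin crit &
  forall x, x \in sols w -> (mult x <= k)%N].
Proof.
case=> z0 [z01 z0c z0n]; set w0 := B z0 in z0c.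
have w01 : md w0 < 1 by apply: B_disk.
have uw0 := regular w01 z0c.
have nz : exists2 z, md z < 1 & gapD k z != 0.
  by exists z0 => //; rewrite mulf_neq0 // expf_neq0 // delta_root.
have [r [rd r0 rP]] := branches a_disk n_gt0 w01 uw0.
have r1 i : md (r i w0) < 1.
  by rewrite r0; apply: (sols_disk w01); rewrite mem_nth // (size_sols a_disk).
have near_ri i : \forall w \near w0, md (r i w) < 1 -> B (r i w) = w ->
  w != w0 ->
    gapD k (r i w) != 0.
  have /near_dnbhs_md[d d0 dP] := isolated_zeros (gapD_Hinfty k) nz (r1 i).
  have [d' d'0 d'P] := (continuous_md _ w0).1 (derivable_continuous
    (rd i)) _ d0.
  apply/near_md; exists d' => // w /d'P rw _ Br ww0; apply: dP => //.
  apply: contra ww0 => /eqP rr; rewrite -Br rr r0; apply/eqP.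
  by apply: (sols_val w01); rewrite mem_nth // (size_sols a_disk).
have near_r : \forall w \near w0, forall i, md (r i w) < 1 -> B (r i w) = w ->
    w != w0 -> gapD k (r i w) != 0.
  exact: (@filter_forall (cplx R) 'I_n (fun i w => md (r i w) < 1 ->
    B (r i w) = w -> w != w0 -> gapD k (r i w) != 0) (nbhs w0)).
have /near_md[d d0 dP] := rP.
have /near_md[d' d'0 d'P] := near_r.
have [w [ww0 wd wd']] : exists w, [/\ w != w0,
  md (w - w0) < d & md (w - w0) < d'].
  have h : \forall w \near w0^', [/\ w != w0,
    md (w - w0) < d & md (w - w0) < d'].
    apply/near_dnbhs_md; exists (Num.min d d'); first by rewrite lt_min d0.
    by move=> u uw; rewrite lt_min => /andP[].
  exact: filter_ex h.
have [w1 pe] := dP w wd; have wP := d'P w wd'.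
have gn x : x \in sols w -> gapD k x != 0.
  move=> xr; have := xr; rewrite (perm_mem pe) => /mapP[i _ xE].
  have x1 := sols_disk w1 xr; have xv := sols_val w1 xr.
  by rewrite xE; apply: wP => //; rewrite -xE.
exists w; split=> //.
  have x0 : (sols w)`_0 \in sols w by rewrite mem_nth // (size_sols a_disk).
  have := gn _ x0; rewrite mulf_eq0 expf_eq0 /= negb_or => /andP[_].
  by rewrite delta_root ?(sols_disk w1) // (sols_val w1).
move=> x /gn; rewrite mulf_eq0 negb_or => /andP[gx _].
by rewrite leqNgt; apply: contra gx => /((gap_order x).1) ->.
Qed.

(** On the generic fibre every value of g is taken exactly k times, so k
    divides n; being greater than 1, it equals n. *)
Lemma g_constant_on_fibres z x : md z < 1 -> B z \notin crit ->
  x \in sols (B z) ->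
  g x = g z.
Proof.
have [k [kn kle]] := generic_order.
have [w [w1 wc wk]] := generic_fibre kn.
have multk y : y \in sols w -> mult y = k.
  move=> yr; apply/anti_leq; rewrite wk //=; apply: kle;
    first exact: (sols_disk w1).
  by rewrite (sols_val w1).
have k_dvd : (k %| n)%N.
  rewrite -(size_sols a_disk w1) -(size_map g); apply: dvdn_size_count.
  move=> _ /mapP[y yr ->]; rewrite count_map -(multk y yr) /mult
    (sols_val w1 yr).
  exact: eq_count.
have k_gt1 : (1 < k)%N.
  have x0 : (sols w)`_0 \in sols w by rewrite mem_nth // (size_sols a_disk).
  rewrite -(multk _ x0); apply: mult_ge2; first exact: (sols_disk w1).
  by rewrite (sols_val w1).
have kn' : k = n.
  by move/primeP: n_prime => [_ /(_ k k_dvd)] /orP[] /eqP // k1;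
    rewrite k1 in k_gt1.
move=> z1 zc xr; have := kle z z1 zc.
rewrite kn' -(size_sols a_disk (B_disk z1)) /mult => h.
have : all (fun y => g y == g z) (sols (B z))
  by rewrite all_count eqn_leq h count_size.
by move=> /allP/(_ x xr)/eqP.
Qed.

(** The first point of the fibre represents it, as g is constant on fibres. *)
Let h0 w := g (sols w)`_0.

Lemma h0E z : md z < 1 -> B z \notin crit -> h0 (B z) = g z.
Proof.
move=> z1 zc; apply: g_constant_on_fibres => //.
by rewrite mem_nth // (size_sols a_disk) // B_disk.
Qed.

Lemma not_crit_near w0 : \forall w \near w0^', w \notin crit.
Proof.
have p0 : \prod_(c <- crit) ('X - c%:P) != 0 :> {poly cplx R}.
  by rewrite prodf_seq_neq0; apply/allP => c _ /=;
    rewrite -size_poly_eq0 size_XsubC.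
apply: filterS (near_poly_neq0 w0 p0) => w.
by rewrite -rootE root_prod_XsubC.
Qed.

(** Near a regular value h0 is g composed with a single branch. *)
Lemma h0_derivable w0 : md w0 < 1 -> w0 \notin crit -> cderivable h0 w0.
Proof.
move=> w1 wc; have uw := regular w1 wc.
have [gd _] := (HinftyP g).1 g_Hinfty.
have [r [rd r0 rP]] := branches a_disk n_gt0 w1 uw.
pose i := Ordinal n_gt0.
have h : cderivable (fun w => g (r i w)) w0.
  apply: (@derivable_comp1 R (r i) g) => //; apply: gd; rewrite r0.
  by apply: (sols_disk w1); rewrite mem_nth // (size_sols a_disk).
apply: derivable_near h.
have /near_md[d1 d10 d1P] := rP.
have /near_dnbhs_md[d2 d20 d2P] := not_crit_near w0.
apply/near_md; exists (Num.min d1 d2); first by rewrite lt_min d10.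
move=> w; rewrite lt_min => /andP[/d1P[ww pe] wd2].
have wcrit : w \notin crit by have [->//|ne] := eqVneq w w0; apply: d2P.
have ri : r i w \in sols w by rewrite (perm_mem pe) map_f ?mem_enum.
have rd1 := sols_disk ww ri; have rv := sols_val ww ri.
by rewrite -[w in h0 w]rv h0E // rv.
Qed.

(** h0 extends over the critical values by [removable]; both g and h o B are
    continuous and the critical fibres have no interior, so they agree. *)
Lemma factors_through_blaschke : Hinfty_comp B g.
Proof.
have [gd [M gM]] := (HinftyP g).1 g_Hinfty.
have h0M w : md w < 1 -> md (h0 w) <= M.
  move=> w1; apply: gM; apply: (sols_disk w1).
  by rewrite mem_nth // (size_sols a_disk).
have ext c : exists L, c \in crit ->
  cderivable (fun w => if w == c then L else h0 w) c.
  have [cc|cc] := boolP (c \in crit); last by exists 0.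
  have c1 := crit_disk cc.
  have /near_dnbhs_md[d d0 dP] := not_crit_near c.
  have r0 : 0 < Num.min d (1 - md c) by rewrite lt_min d0; lra.
  have [|L LP] := @removable R h0 c _ M r0; last by exists L.
  move=> w wc; rewrite lt_min => /andP[wd w1'].
  have w1 : md w < 1 by have := mdD (w - c) c; rewrite subrK; lra.
  by split; [apply: h0M | apply: h0_derivable => //; apply: dP].
have [L LP] := choice ext.
pose h w := if w \in crit then L w else h0 w.
have hd w : md w < 1 -> cderivable h w.
  move=> w1; have /near_dnbhs_md[d d0 dP] := not_crit_near w.
  have [wc|wc] := boolP (w \in crit).
    apply: derivable_near (LP w wc); apply/near_md; exists d => // u ud.
    rewrite /h; have [->|uw] := eqVneq u w; first by rewrite wc.
    by rewrite (negPf (dP u uw ud)).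
  apply: derivable_near (h0_derivable w1 wc); apply/near_md;
    exists d => // u ud.
  rewrite /h; have [->|uw] := eqVneq u w; first by rewrite (negPf wc).
  by rewrite (negPf (dP u uw ud)).
have gh z : md z < 1 -> g z = h (B z).
  move=> z1; apply: (@ccont_eq R g (fun u => h (B u))).
  - exact: derivable_continuous (gd _ z1).
  - apply: derivable_continuous.
    exact: derivable_comp1 (derivable_blaschke a_disk z1) (hd _ (B_disk z1)).
  - apply: filterS (regular_near z1) => u [u1 uc].
    by rewrite /h (negPf uc) h0E.
exists h; split; last by move=> z /unit_diskE; apply: gh.
apply/HinftyP; split=> //; exists M => w w1.
have x0 : (sols w)`_0 \in sols w by rewrite mem_nth // (size_sols a_disk).
have x1 := sols_disk w1 x0.
by rewrite -(sols_val w1 x0) -gh //; apply: gM.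
Qed.

End Main.

Theorem mainTheorem5 (R : realType) (n : nat) (a : 'I_n -> cplx R)
    (g : cplx R -> cplx R) (n_prime : prime n)
    (a_disk : forall j, unit_disk (a j))
    (g_Hinfty : Hinfty g)
    (g_notin : ~ Hinfty_comp (blaschke a) g) :
  exists z : cplx R, unit_disk z /\ Gamma (blaschke a) g z != 0.
Proof.
have a1 j : md (a j) < 1 by apply/unit_diskE.
have n_gt0 := prime_gt0 n_prime.
apply: contrapT => Gamma_ne0; apply: g_notin.
have Gamma0 z : md z < 1 -> Gamma (blaschke a) g z = 0.
  move=> z1; apply/eqP/negPn/negP => h; apply: Gamma_ne0; exists z.
  by split=> //; apply/unit_diskE.
have [crit crit_disk crit_regular] := critical_values a1 n_gt0.
apply: (@factors_through_blaschke R n a g a1 n_prime g_Hinfty _ crit) =>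
  // z z1 uz.
have := Gamma0 z z1; rewrite /Gamma (derive1_blaschke_neq0 a1 n_gt0 z1 uz).
have pe := fiber_sols a1 n_gt0 z1.
have uf : uniq (fiber (blaschke a) z) by rewrite (perm_uniq pe).
move=> /eqP; rewrite /Gamma_prod prodf_seq_eq0 => /hasP[x].
rewrite mem_rem_uniq // inE => /andP[xz xf] /=.
have zx : z - x != 0 by rewrite subr_eq0 eq_sym.
rewrite mulf_eq0 invr_eq0 (negPf zx) orbF subr_eq0 => /eqP gx.
by exists x; rewrite -?(perm_mem pe).
Qed.
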